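(* Let $I=\{i_1<i_2<i_3\}\subseteq\{1,\dots,t\}$, let $1\le b_i\le p_i-1$ for $i\in I$, and let $\vec y=n\vec c+\sum_{i=1}^ta_i\vec x_i$ with $n\ge0$ and $0\le a_i\le p_i-1$, such that $a_{i_3}+b_{i_3}\ge p_{i_3}$ and $a_i+b_i<p_i$ for $i\in\{i_1,i_2\}$ (type $\mathrm B_3$). Put $c_{i_3}=a_{i_3}+b_{i_3}-p_{i_3}$. Let $E$ be the cokernel of the map $[x_i^{b_i}]_{i\in I}:\mathcal O(\vec y)\to\bigoplus_{i\in I}\mathcal O(\vec y+b_i\vec x_i)$, regarded as a $\Lambda$-module. Then $E$ is isomorphic to the representation given by the following vector spaces and matrices. Vector spaces: $E_0=k^{2n+3}$, $E_{\vec c}=k^{2n+1}$; for $j\notin I$, $E_{m\vec x_j}=k^{2n+3}$ for $1\le m\le a_j$ and $k^{2n+1}$ for $a_j+1\le m\le p_j-1$; for $i\in\{i_1,i_2\}$, $E_{m\vec x_i}=k^{2n+3}$ for $1\le m\le a_i$, $k^{2n+2}$ for $a_i+1\le m\le a_i+b_i$, $k^{2n+1}$ for $a_i+b_i+1\le m\le p_i-1$; and $E_{m\vec x_{i_3}}=k^{2n+3}$ for $1\le m\le c_{i_3}$, $k^{2n+2}$ for $c_{i_3}+1\le m\le a_{i_3}$, $k^{2n+1}$ for $a_{i_3}+1\le m\le p_{i_3}-1$. Matrices (in block form): $$E_{\alpha^{(1)}_1}=E_{\alpha^{(2)}_1}=\mathrm{id},\qquad E_{\alpha^{(j)}_1}=\begin{pmatrix}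 Z_{n+1}(\lambda_j) & 0 \\ 0 & Z_{n+2}(\lambda_j) \end{pmatrix}\ (j>2),$$ $$E_{\alpha^{(i_1)}_{a_{i_1}+1}}=\begin{pmatrix} -I_{n+1} & 0 \\ Z_{n+2\times n+1}(-\lambda_{i_3}) & X_{n+2\times n+1} \end{pmatrix},\qquad E_{\alpha^{(i_1)}_{a_{i_1}+b_{i_1}+1}}=\begin{pmatrix} -X_{n+1\times n} & 0 \\ Z_{n+1\times n}(-\lambda_{i_3}) & I_{n+1} \end{pmatrix},$$ $$E_{\alpha^{(i_2)}_{a_{i_2}+1}}=\begin{pmatrix} I_{n+1} & 0 \\ 0 & X_{n+2\times n+1} \end{pmatrix},\qquad E_{\alpha^{(i_2)}_{a_{i_2}+b_{i_2}+1}}=\begin{pmatrix} X_{n+1\times n} & 0 \\ 0 & I_{n+1} \end{pmatrix},$$ $$E_{\alpha^{(i_3)}_{c_{i_3}+1}}=\begin{pmatrix} I_{n+1} & 0 \\ 0 & X_{n+2\times n+1} \end{pmatrix},\qquad E_{\alpha^{(i_3)}_{a_{i_3}+1}}=\begin{pmatrix} X_{n+1\times n} & 0 \\ 0 & I_{n+1} \end{pmatrix},$$ $$E_{\alpha^{(j)}_{a_j+1}}=\begin{pmatrix} X_{n+1\times n} & 0 \\ 0 & X_{n+2\times n+1} \end{pmatrix}\quad(j\notin I),$$ and $E_\alpha=\mathrm{id}$ for all remaining arrows $\alpha$. For the second arm all matrices $X_{*\times*}$ are to be replaced by $Y_{*\times*}$. If $a_i=0$ for some $i\neq i_3$ (resp.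 $c_{i_3}=0$), so that the arrow $\alpha^{(i)}_1$ coincides with $\alpha^{(i)}_{a_i+1}$ (resp. $\alpha_1^{(i_3)}$ with $\alpha^{(i_3)}_{c_{i_3}+1}$), then the matrix of this arrow is the product $E_{\alpha^{(i)}_1}\cdot E_{\alpha^{(i)}_{a_i+1}}$ (resp. $E_{\alpha^{(i_3)}_1}\cdot E_{\alpha^{(i_3)}_{c_{i_3}+1}}$) of the two matrices listed above.
   Context: $k$ is an algebraically closed field, $t\ge3$, $p_i\ge2$ ($1\le i\le t$) are integers and $\lambda_3=1,\lambda_4,\dots,\lambda_t\in k$ are pairwise distinct nonzero parameters. $\mathbb L$ is the abelian group generated by $\vec x_1,\dots,\vec x_t$ with relations $p_1\vec x_1=\dots=p_t\vec x_t=:\vec c$, ordered with positive cone $\sum_i\mathbb N\vec x_i$. The algebra $S=k[x_1,\dots,x_t]/(x_i^{p_i}-x_1^{p_1}-\lambda_ix_2^{p_2}\mid i\ge3)$ is $\mathbb L$-graded with $\deg x_i=\vec x_i$, and $\mathbb X$ (weighted projective line) is its $\mathbb L$-graded projective spectrum; line bundles are the $\mathcal O(\vec x)$, with $\mathrm{Hom}_{\mathbb X}(\mathcal O(\vec x),\mathcal O(\vec y))\cong S_{\vec y-\vec x}$, so $x_i^b$ defines a map $L\to L(b\vec x_i)$ for every line bundle $L$. $T=\bigoplus_{0\le\vec x\le\vec c}\mathcal O(\vec x)$ is a tilting bundle with $\mathrm{End}_{\mathbb X}(T)=\Lambda$ the canonical algebra: the path algebra of the quiver with vertices $0$, $m\vec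 x_i$ ($1\le m\le p_i-1$), $\vec c$ and arrows $\alpha^{(i)}_m:(m-1)\vec x_i\to m\vec x_i$, $1\le m\le p_i$ ($0\vec x_i=0$, $p_i\vec x_i=\vec c$), modulo $\alpha^{(i)}_{p_i}\cdots\alpha^{(i)}_1=\alpha^{(1)}_{p_1}\cdots\alpha^{(1)}_1+\lambda_i\alpha^{(2)}_{p_2}\cdots\alpha^{(2)}_1$, $i\ge3$. A (right) $\Lambda$-module $M$ is given by vector spaces $M_v$ and linear maps $M_\alpha:M_w\to M_v$ for arrows $\alpha:v\to w$, satisfying the relations. Vector bundles $F$ with $\mathrm{Ext}^1_{\mathbb X}(T,F)=0$ are identified with the $\Lambda$-modules $\mathrm{Hom}_{\mathbb X}(T,F)$ (with $M_{\vec x}=\mathrm{Hom}_{\mathbb X}(\mathcal O(\vec x),F)$); the bundle $E$ of the claim is of this kind. Matrices: $I_n$ is the identity of size $n$; $X_{n+m\times n}=\begin{pmatrix} I_n \\ 0 \end{pmatrix}$ and $Y_{n+m\times n}=\begin{pmatrix} 0 \\ I_n \end{pmatrix}$ are $(n+m)\times n$ matrices; $Z_n(\lambda)$ is the $n\times n$ matrix with $1$ on the diagonal, $\lambda$ on the first subdiagonal, and $0$ elsewhere; $Z_{n+1\times n}(\lambda)=X_{n+1\times n}+\lambda Y_{n+1\times n}$ is the $(n+1)\times n$ matrix with $1$ on the diagonal and $\lambda$ on the first subdiagonal. Matrices with $0$ rows or columns are allowed. *)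

(* Defs.v *)
From HB Require Import structures.
From mathcomp Require Import all_boot all_order all_algebra.
From mathcomp Require Import generic_quotient ring_quotient ring.
From mathcomp Require Import boolp.
From mathcomp Require Import mpoly.

Set Implicit Arguments.
Unset Strict Implicit.
Unset Printing Implicit Defensive.

Import GRing.Theory.
Local Open Scope ring_scope.
Local Open Scope quotient_scope.

(* Localization of a commutative ring at a multiplicatively closed subset, by the
   usual relation on fractions (R need not be a domain). *)
Section Localization.
Variables (R : comNzRingType) (M : mulrClosed R).

Definition locrep : Type := (R * {f : R | f \in M})%type.
HB.instance Definition _ := Choice.on locrep.

Definition loc_eq (u v : locrep) : bool :=
  `[< exists2 h, h \in M & h * (u.1 * sval v.2 - v.1 * sval u.2) = 0 >].

Lemma loc_eq_refl : reflexive loc_eq.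
Proof. by move=> u; apply/asboolP; exists 1; rewrite ?rpred1 // subrr mulr0. Qed.

Lemma loc_eq_sym : ssrbool.symmetric loc_eq.
Proof.
move=> u v; apply/asbool_equiv_eq.
by split=> -[h hM e]; exists h => //; rewrite -opprB mulrN e oppr0.
Qed.

Lemma loc_eq_trans : transitive loc_eq.
Proof.
move=> v u w /asboolP[h hM e1] /asboolP[g gM e2]; apply/asboolP.
exists (h * g * sval v.2); first by rewrite !rpredM // (valP v.2).
transitivity (g * sval w.2 * (h * (u.1 * sval v.2 - v.1 * sval u.2))
     + h * sval u.2 * (g * (v.1 * sval w.2 - w.1 * sval v.2))); first by ring.
by rewrite e1 e2 !mulr0 addr0.
Qed.

Canonical loc_equiv := EquivRel loc_eq loc_eq_refl loc_eq_sym loc_eq_trans.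

Definition loc : Type := {eq_quot loc_eq}.
HB.instance Definition _ : EqQuotient locrep loc_eq loc := EqQuotient.on loc.
HB.instance Definition _ := Choice.on loc.

Definition den1 : {f : R | f \in M} := exist _ 1 (rpred1 M).
Definition denM (f g : {f : R | f \in M}) : {f : R | f \in M} :=
  exist _ (sval f * sval g) (rpredM (valP f) (valP g)).

Definition addrep (u v : locrep) : locrep :=
  (u.1 * sval v.2 + v.1 * sval u.2, denM u.2 v.2).
Definition opprep (u : locrep) : locrep := (- u.1, u.2).
Definition mulrep (u v : locrep) : locrep := (u.1 * v.1, denM u.2 v.2).

Definition loc0 : loc := lift_cst loc (0, den1).
Definition loc1 : loc := lift_cst loc (1, den1).
Definition loc_opp := lift_op1 loc opprep.
Definition loc_add := lift_op2 loc addrep.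
Definition loc_mul := lift_op2 loc mulrep.

Canonical pi_loc0_morph := PiConst loc0.
Canonical pi_loc1_morph := PiConst loc1.

Lemma repr_loc_eq (u : locrep) : 
  exists2 h, h \in M &
   h * (u.1 * sval (repr (\pi_loc u)).2 - (repr (\pi_loc u)).1 * sval u.2) = 0.
Proof. by apply/asboolP; rewrite -[X in is_true X]/(loc_eq _ _) -(eqmodE loc_equiv) /= reprK. Qed.

Lemma pi_loc_opp : {morph \pi : x / opprep x >-> loc_opp x}.
Proof.
move=> x; unlock loc_opp; apply/eqP; rewrite piE; apply/asboolP => /=.
have [h hM e] := repr_loc_eq x; exists h => //.
by rewrite !mulNr -opprD mulrN e oppr0.
Qed.
Canonical pi_loc_opp_morph := PiMorph1 pi_loc_opp.

Lemma pi_loc_add : {morph \pi : x y / addrep x y >-> loc_add x y}.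
Proof.
move=> x y; unlock loc_add; apply/eqP; rewrite piE; apply/asboolP => /=.
have [h hM e] := repr_loc_eq x; have [g gM e'] := repr_loc_eq y.
move: e e'; set x' := repr _; set y' := repr _ => e e'.
exists (h * g); first by rewrite rpredM.
transitivity (g * sval y.2 * sval y'.2 * (h * (x.1 * sval x'.2 - x'.1 * sval x.2))
  + h * sval x.2 * sval x'.2 * (g * (y.1 * sval y'.2 - y'.1 * sval y.2))).
  by ring.
by rewrite e e' !mulr0 addr0.
Qed.
Canonical pi_loc_add_morph := PiMorph2 pi_loc_add.

Lemma pi_loc_mul : {morph \pi : x y / mulrep x y >-> loc_mul x y}.
Proof.
move=> x y; unlock loc_mul; apply/eqP; rewrite piE; apply/asboolP => /=.
have [h hM e] := repr_loc_eq x; have [g gM e'] := repr_loc_eq y.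
move: e e'; set x' := repr _; set y' := repr _ => e e'.
exists (h * g); first by rewrite rpredM.
transitivity (g * y.1 * sval y'.2 * (h * (x.1 * sval x'.2 - x'.1 * sval x.2))
  + h * x'.1 * sval x.2 * (g * (y.1 * sval y'.2 - y'.1 * sval y.2))).
  by ring.
by rewrite e e' !mulr0 addr0.
Qed.
Canonical pi_loc_mul_morph := PiMorph2 pi_loc_mul.

Lemma loc_eq1 (u v : locrep) :
  u.1 * sval v.2 = v.1 * sval u.2 -> u = v %[mod loc].
Proof.
move=> e; apply/eqP; rewrite piE; apply/asboolP.
by exists 1; rewrite ?rpred1 // e subrr mulr0.
Qed.

Lemma loc_addA : associative loc_add.
Proof.
elim/quotW => x; elim/quotW => y; elim/quotW => z; rewrite !piE.
by apply: loc_eq1 => /=; ring.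
Qed.

Lemma loc_addC : commutative loc_add.
Proof.
by elim/quotW => x; elim/quotW => y; rewrite !piE; apply: loc_eq1 => /=; ring.
Qed.

Lemma loc_add0 : left_id loc0 loc_add.
Proof. by elim/quotW => x; rewrite !piE; apply: loc_eq1 => /=; ring. Qed.

Lemma loc_addN : left_inverse loc0 loc_opp loc_add.
Proof. by elim/quotW => x; rewrite !piE; apply: loc_eq1 => /=; ring. Qed.

HB.instance Definition _ :=
  GRing.isZmodule.Build loc loc_addA loc_addC loc_add0 loc_addN.

Lemma loc_mulA : associative loc_mul.
Proof.
elim/quotW => x; elim/quotW => y; elim/quotW => z; rewrite !piE.
by apply: loc_eq1 => /=; ring.
Qed.

Lemma loc_mulC : commutative loc_mul.
Proof.
by elim/quotW => x; elim/quotW => y; rewrite !piE; apply: loc_eq1 => /=; ring.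
Qed.

Lemma loc_mul1 : left_id loc1 loc_mul.
Proof. by elim/quotW => x; rewrite !piE; apply: loc_eq1 => /=; ring. Qed.

Lemma loc_mulD : left_distributive loc_mul loc_add.
Proof.
elim/quotW => x; elim/quotW => y; elim/quotW => z; rewrite !piE.
by apply: loc_eq1 => /=; ring.
Qed.

HB.instance Definition _ := GRing.Zmodule_isComPzRing.Build loc
  loc_mulA loc_mulC loc_mul1 loc_mulD.

Definition frac (a f : R) (fM : f \in M) : loc := \pi_loc (a, exist _ f fM).

Definition toloc (a : R) : loc := frac a (rpred1 M).

Lemma fracD a b f g (fM : f \in M) (gM : g \in M) :
  frac a fM + frac b gM = frac (a * g + b * f) (rpredM fM gM).
Proof.
by apply: etrans (esym (pi_loc_add _ _)) _; apply: loc_eq1.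
Qed.

Lemma fracM a b f g (fM : f \in M) (gM : g \in M) :
  frac a fM * frac b gM = frac (a * b) (rpredM fM gM).
Proof.
by apply: etrans (esym (pi_loc_mul _ _)) _; apply: loc_eq1.
Qed.

Lemma fracN a f (fM : f \in M) : - frac a fM = frac (- a) fM.
Proof.
by apply: etrans (esym (pi_loc_opp _)) _; apply: loc_eq1.
Qed.

Lemma frac_eq a b f g (fM : f \in M) (gM : g \in M) :
  a * g = b * f -> frac a fM = frac b gM.
Proof. by move=> e; apply: loc_eq1. Qed.

Lemma toloc_zmod_morphism : zmod_morphism toloc.
Proof. by move=> a b; rewrite /toloc fracN fracD; apply: frac_eq; ring. Qed.
HB.instance Definition _ :=
  GRing.isZmodMorphism.Build R loc toloc toloc_zmod_morphism.

Lemma toloc_monoid_morphism : monoid_morphism toloc.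
Proof.
split=> [|a b]; last by rewrite /toloc fracM; apply: frac_eq; ring.
by rewrite -[RHS]/loc1; unlock loc1; apply: loc_eq1.
Qed.
HB.instance Definition _ :=
  GRing.isMonoidMorphism.Build R loc toloc toloc_monoid_morphism.

End Localization.

Arguments frac {R M} a {f} fM.
Arguments toloc {R} M a.

Section Cokernel.
Variables (R : pzRingType) (U V : lmodType R) (u : {linear U -> V}).

Definition im : {pred V} := fun v => `[< exists w, v = u w >].

Lemma im_submod : submod_closed im.
Proof.
split=> [|c v w]; first by apply/asboolP; exists 0; rewrite raddf0.
move=> /asboolP[v' ->] /asboolP[w' ->]; apply/asboolP.
by exists (c *: v' + w'); rewrite linearP.
Qed.
HB.instance Definition _ := GRing.isSubmodClosed.Build R V im im_submod.

Definition im_zmod : zmodClosed V := GRing.ZmodClosed.clone V im _.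

Local Notation Q := (Quotient.quot im_zmod).
Definition coker : Type := Q.
HB.instance Definition _ := GRing.Zmodule.on coker.
Definition tocoker (v : V) : coker := \pi_Q v.

Definition coker_scale (c : R) (x : coker) : coker :=
  tocoker (c *: repr (x : Q)).

Lemma tocoker_zmod_morphism : zmod_morphism tocoker.
Proof. by move=> x y; rewrite /tocoker !piE. Qed.
HB.instance Definition _ :=
  GRing.isZmodMorphism.Build V coker tocoker tocoker_zmod_morphism.

Lemma tocoker_eq0 v : tocoker v = 0 <-> exists w, v = u w.
Proof.
rewrite -(raddf0 tocoker); split.
  move=> /(@eqP Q); rewrite -Quotient.idealrBE subr0.
  by move/asboolP.
move=> h; apply/(@eqP Q); rewrite -Quotient.idealrBE subr0.
by apply/asboolP.
Qed.

Lemma tocoker_surj x : exists v, x = tocoker v.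
Proof. by exists (repr (x : Q)); rewrite /tocoker reprK. Qed.

Lemma tocokerZ c v : coker_scale c (tocoker v) = tocoker (c *: v).
Proof.
apply/eqP; rewrite -subr_eq0 -raddfB -scalerBr; apply/eqP/tocoker_eq0.
have /tocoker_eq0[w ->] : tocoker (repr (tocoker v : Q) - v) = 0.
  by rewrite raddfB /= {1}/tocoker reprK subrr.
by exists (c *: w); rewrite linearZ.
Qed.

Lemma coker_scaleA a b x :
  coker_scale a (coker_scale b x) = coker_scale (a * b) x.
Proof. by have [v ->] := tocoker_surj x; rewrite !tocokerZ scalerA. Qed.
Lemma coker_scale1 : left_id 1 coker_scale.
Proof. by move=> x; have [v ->] := tocoker_surj x; rewrite tocokerZ scale1r. Qed.
Lemma coker_scaleDr : right_distributive coker_scale +%R.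
Proof.
move=> c x y; have [v ->] := tocoker_surj x; have [w ->] := tocoker_surj y.
by rewrite -raddfD !tocokerZ scalerDr raddfD.
Qed.
Lemma coker_scaleDl x : {morph coker_scale^~ x : a b / a + b}.
Proof.
by move=> a b; have [v ->] := tocoker_surj x; rewrite !tocokerZ scalerDl raddfD.
Qed.
HB.instance Definition _ := GRing.Zmodule_isLmodule.Build R coker
  coker_scaleA coker_scale1 coker_scaleDr coker_scaleDl.

Lemma tocoker_scalable : scalable tocoker.
Proof. by move=> c v; rewrite -[RHS]/(coker_scale _ _) tocokerZ. Qed.
HB.instance Definition _ :=
  GRing.isScalable.Build R V coker *:%R tocoker tocoker_scalable.

End Cokernel.

(* Arms are numbered from 0: the ordinal of value [j] is the arm $j+1$.  Only
   the values [lam i] with [2 <= i] are meaningful. *)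
Record weights (k : fieldType) := Weights {
  nb : nat;
  wt : 'I_nb -> nat;
  lam : 'I_nb -> k;
  nb_ge3 : (2 < nb)%N;
  wt_ge2 : forall i, (2 <= wt i)%N;
  lam3 : lam (Ordinal nb_ge3) = 1;
  lam_neq0 : forall i : 'I_nb, (2 <= i)%N -> lam i != 0;
  lam_inj : forall i j : 'I_nb, (2 <= i)%N -> (2 <= j)%N ->
    lam i = lam j -> i = j }.

Section WeightedProjectiveLine.
Variables (k : fieldType) (W : weights k).
Local Notation t := (nb W).
Local Notation p := (@wt k W).

Definition arm1 : 'I_t := Ordinal (ltnW (ltnW (nb_ge3 W))).
Definition arm2 : 'I_t := Ordinal (ltnW (nb_ge3 W)).

(* The group L, as the quotient of the free abelian group on the x_i by the
   subgroup generated by the p_i x_i - p_1 x_1. *)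
Definition Lfree := 'rV[int]_t.
Definition Lgen (i : 'I_t) : Lfree :=
  delta_mx 0 i *+ p i - delta_mx 0 arm1 *+ p arm1.
Definition Lrel : {pred Lfree} :=
  fun z => `[< exists m : 'I_t -> int, z = \sum_i Lgen i *~ m i >].

Lemma Lrel_zmod : zmod_closed Lrel.
Proof.
split=> [|z w /asboolP[m ->] /asboolP[m' ->]]; apply/asboolP.
  by exists (fun=> 0); rewrite big1 // => i _; rewrite mulr0z.
exists (fun i => m i - m' i); rewrite -sumrB; apply: eq_bigr => i _.
by rewrite mulrzBr.
Qed.
HB.instance Definition _ := GRing.isZmodClosed.Build Lfree Lrel Lrel_zmod.

Definition LL : Type :=
  Quotient.quot (GRing.ZmodClosed.clone Lfree Lrel _).
HB.instance Definition _ := GRing.Zmodule.on LL.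
Definition toL (z : Lfree) : LL :=
  \pi_(Quotient.quot (GRing.ZmodClosed.clone Lfree Lrel _)) z.

Definition xv (i : 'I_t) : LL := toL (delta_mx 0 i).
Definition cv : LL := xv arm1 *+ p arm1.

Lemma toL_zmod_morphism : zmod_morphism toL.
Proof. by move=> x y; rewrite /toL !piE. Qed.
HB.instance Definition _ :=
  GRing.isZmodMorphism.Build Lfree LL toL toL_zmod_morphism.

Lemma cvE i : cv = xv i *+ p i.
Proof.
rewrite /cv /xv -!raddfMn; apply/esym/eqP.
rewrite -[_ == _]/(_ == _ :> Quotient.quot (GRing.ZmodClosed.clone Lfree Lrel _)).
rewrite -Quotient.idealrBE; apply/asboolP; exists (fun j => (i == j)%:R).
rewrite (bigD1 i) //= eqxx mulr1z big1 ?addr0 // => j /negPf.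
by rewrite eq_sym => ->; rewrite mulr0z.
Qed.

(* The algebra S. *)
Local Notation A := {mpoly k[t]}.

Definition Sgen (i : 'I_t) : A :=
  'X_i ^+ p i - 'X_arm1 ^+ p arm1 - lam i *: 'X_arm2 ^+ p arm2.
Definition Srel : {pred A} := fun f =>
  `[< exists q : 'I_t -> A, f = \sum_(i : 'I_t | (2 <= i)%N) q i * Sgen i >].

Lemma Srel_idealr : idealr_closed Srel.
Proof.
have p_gt0 i : p i != 0%N by rewrite -lt0n (leq_trans _ (wt_ge2 i)).
split=> [||c f g /asboolP[q ->] /asboolP[q' ->]].
- apply/asboolP; exists (fun=> 0); rewrite big1 // => i _; exact: mul0r.
- apply/negP => /asboolP[q /(congr1 (meval (fun=> 0 : k)))] /eqP.
  rewrite rmorph1 rmorph_sum big1 ?oner_eq0 // => i _.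
  rewrite rmorphM /Sgen !rmorphB /= mevalZ !rmorphXn /= !mevalXU.
  by rewrite !expr0n !(negPf (p_gt0 _)) mulr0 !subr0 mulr0.
- apply/asboolP; exists (fun i => c * q i + q' i).
  rewrite mulr_sumr -big_split; apply: eq_bigr => i _.
  by rewrite mulrA /= mulrDl.
Qed.
HB.instance Definition _ := isIdealr.Build A Srel Srel_idealr.

Definition SS : Type := {ideal_quot (Idealr.clone A Srel _)}.
HB.instance Definition _ := GRing.ComNzRing.on SS.
Definition toS (f : A) : SS := \pi_{ideal_quot (Idealr.clone A Srel _)} f.

Lemma toS_zmod_morphism : zmod_morphism toS.
Proof. by move=> x y; rewrite /toS !piE. Qed.
HB.instance Definition _ :=
  GRing.isZmodMorphism.Build A SS toS toS_zmod_morphism.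
Lemma toS_monoid_morphism : monoid_morphism toS.
Proof. by split=> [|x y]; rewrite /toS !piE. Qed.
HB.instance Definition _ :=
  GRing.isMonoidMorphism.Build A SS toS toS_monoid_morphism.

Definition kS (c : k) : SS := toS c%:MP.
Definition xS (i : 'I_t) : SS := toS 'X_i.

(* [Sdeg z s]: s is homogeneous of degree z. *)
Definition mdegL (m : 'X_{1..t}) : LL := \sum_i xv i *+ m i.
Definition Sdeg (z : LL) (s : SS) : Prop :=
  exists2 f : A, (forall m, m \in msupp f -> mdegL m = z) & s = toS f.
Definition Shomog (s : SS) : Prop := exists z, Sdeg z s.

Lemma Sdeg0 z : Sdeg z 0.
Proof. by exists 0; rewrite ?raddf0 // => m; rewrite msupp0. Qed.

Lemma SdegD z s s' : Sdeg z s -> Sdeg z s' -> Sdeg z (s + s').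
Proof.
move=> [f hf ->] [g hg ->]; exists (f + g); last by rewrite raddfD.
by move=> m /msuppD_le; rewrite mem_cat => /orP[/hf|/hg].
Qed.

Lemma SdegM z z' s s' : Sdeg z s -> Sdeg z' s' -> Sdeg (z + z') (s * s').
Proof.
move=> [f hf ->] [g hg ->]; exists (f * g); last by rewrite rmorphM.
move=> m /msuppM_le /allpairsP[[m1 m2] /= [/hf <- /hg <- ->]].
rewrite /mdegL -big_split; apply: eq_bigr => i _ /=.
by rewrite mnmDE mulrnDr.
Qed.

Lemma SdegC c : Sdeg 0 (kS c).
Proof.
exists c%:MP => // m; rewrite msuppC; case: eqP => // _; rewrite inE => /eqP ->.
by rewrite /mdegL big1 // => i _; rewrite mnm0E mulr0n.
Qed.

Lemma cS1 : kS 1 = 1. Proof. by rewrite /kS mpolyC1 rmorph1. Qed.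
Lemma cSD : {morph kS : a b / a + b}.
Proof. by move=> a b; rewrite /kS mpolyCD rmorphD. Qed.
Lemma cSM : {morph kS : a b / a * b}.
Proof. by move=> a b; rewrite /kS mpolyCM rmorphM. Qed.

Lemma Sdeg1 : Sdeg 0 1.
Proof. by rewrite -cS1; exact: SdegC. Qed.

Lemma Sdegx i : Sdeg (xv i) (xS i).
Proof.
exists 'X_i => // m; rewrite msuppX inE => /eqP ->.
rewrite /mdegL (bigD1 i) //= mnm1E eqxx mulr1n big1 ?addr0 // => j ji.
by rewrite mnm1E eq_sym (negPf ji).
Qed.

(* The points of X = Proj S: L-homogeneous ideals not containing the irrelevant
   ideal (x_1, ..., x_t) which are prime in the L-graded sense, i.e. with
   respect to homogeneous elements.  As L may have torsion, such an ideal need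
   not be prime. *)
Record point := Point {
  pt :> SS -> Prop;
  pt0 : pt 0;
  ptD : forall a b, pt a -> pt b -> pt (a + b);
  ptM : forall c a, pt a -> pt (c * a);
  pt_homog : forall a, pt a -> exists2 r : seq SS,
    forall b, b \in r -> pt b /\ Shomog b & a = \sum_(b <- r) b;
  pt_prime : forall a b, Shomog a -> Shomog b -> pt (a * b) -> pt a \/ pt b;
  pt_irr : exists i, ~ pt (xS i) }.

Definition denom (P : point) : {pred SS} := fun f => `[< Shomog f /\ ~ P f >].

Lemma denom_mulr P : mulr_closed (denom P).
Proof.
split=> [|f g /asboolP[[z fz] fP] /asboolP[[w gw] gP]]; apply/asboolP.
  split; first by exists 0; apply: Sdeg1.
  by have [i xP] := pt_irr P; move=> /(ptM (xS i)); rewrite mulr1.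
split; first by exists (z + w); apply: SdegM.
by move=> /pt_prime; case=> //; [exists z|exists w].
Qed.
HB.instance Definition _ P :=
  GRing.isMulClosed.Build SS (denom P) (denom_mulr P).

(* The localization of S at the homogeneous elements outside P; its part of
   degree z is the stalk at P of the line bundle O(z). *)
Definition locS (P : point) : Type :=
  loc (GRing.MulClosed.clone SS (denom P) _).
HB.instance Definition _ P := GRing.ComPzRing.on (locS P).
Definition fracS (P : point) (a f : SS) (fP : f \in denom P) : locS P :=
  frac (M := GRing.MulClosed.clone SS (denom P) _) a fP.
Definition tolocS (P : point) (a : SS) : locS P :=
  toloc (GRing.MulClosed.clone SS (denom P) _) a.
HB.instance Definition _ P := GRing.RMorphism.copy (tolocS P)
  (toloc (GRing.MulClosed.clone SS (denom P) _)).

Section CokernelSheaf.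
Variables (I : {set 'I_t}) (b : 'I_t -> nat) (y : LL).

(* The map [x_i^(b_i)]_(i in I) on stalks (all degrees together), and the stalk
   of its cokernel E. *)
Definition stalk_map (P : point) (c : (locS P)^o) :
    {ffun {i : 'I_t | i \in I} -> (locS P)^o} :=
  [ffun i => tolocS P (xS (val i) ^+ b (val i)) * c].

Lemma stalk_map_linear P : linear (stalk_map (P := P)).
Proof.
move=> c u v; apply/ffunP => i; rewrite !ffunE mulrDr; congr (_ + _).
exact: mulrCA.
Qed.
HB.instance Definition _ P := GRing.isLinear.Build (locS P) (locS P)^o
  {ffun {i : 'I_t | i \in I} -> (locS P)^o} *:%R (@stalk_map P)
  (@stalk_map_linear P).

Definition stalk (P : point) : Type := coker (@stalk_map P).
HB.instance Definition _ P := GRing.Lmodule.on (stalk P).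

Definition stalk_frac (P : point) (a : {i : 'I_t | i \in I} -> SS) (f : SS)
    (fP : f \in denom P) : stalk P :=
  tocoker (@stalk_map P) [ffun i => fracS (a i) fP].

(* Families of germs of E, a k-vector space through k -> S -> locS P. *)
Definition germs : Type := forall P : point, stalk P.
HB.instance Definition _ := Choice.on germs.

Definition germs0 : germs := fun=> 0.
Definition germs_opp (g : germs) : germs := fun P => - g P.
Definition germs_add (g h : germs) : germs := fun P => g P + h P.
Definition germs_scale (c : k) (g : germs) : germs :=
  fun P => tolocS P (kS c) *: g P.

Lemma germs_addA : associative germs_add.
Proof. by move=> f g h; apply: functional_extensionality_dep => P; exact: addrA. Qed.
Lemma germs_addC : commutative germs_add.
Proof. by move=> f g; apply: functional_extensionality_dep => P; exact: addrC. Qed.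
Lemma germs_add0 : left_id germs0 germs_add.
Proof. by move=> g; apply: functional_extensionality_dep => P; exact: add0r. Qed.
Lemma germs_addN : left_inverse germs0 germs_opp germs_add.
Proof. by move=> g; apply: functional_extensionality_dep => P; exact: addNr. Qed.
HB.instance Definition _ :=
  GRing.isZmodule.Build germs germs_addA germs_addC germs_add0 germs_addN.

Lemma germs_scaleA c d g :
  germs_scale c (germs_scale d g) = germs_scale (c * d) g.
Proof.
apply: functional_extensionality_dep => P.
by rewrite /germs_scale scalerA -rmorphM cSM.
Qed.
Lemma germs_scale1 : left_id 1 germs_scale.
Proof.
move=> g; apply: functional_extensionality_dep => P.
by rewrite /germs_scale cS1 rmorph1 scale1r.
Qed.
Lemma germs_scaleDr : right_distributive germs_scale +%R.
Proof.
by move=> c g h; apply: functional_extensionality_dep => P; exact: scalerDr.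
Qed.
Lemma germs_scaleDl g : {morph germs_scale^~ g : c d / c + d}.
Proof.
move=> c d; apply: functional_extensionality_dep => P.
by rewrite /germs_scale cSD rmorphD scalerDl.
Qed.
HB.instance Definition _ := GRing.Zmodule_isLmodule.Build k germs
  germs_scaleA germs_scale1 germs_scaleDr germs_scaleDl.

(* A global section of degree z of the L-graded sheaf E: a family of germs
   which, on a neighbourhood {Q | h notin Q} of each point P, is the image of a
   section (a_i / f)_i of degree z of the direct sum of the O(y + b_i x_i). *)
Definition is_section (z : LL) : {pred germs} := fun g =>
  `[< forall P : point, exists (h f : SS) (a : {i : 'I_t | i \in I} -> SS)
        (d : LL),
      [/\ h \in denom P, Sdeg d f,
          forall i, Sdeg (y + xv (val i) *+ b (val i) + z + d) (a i) &
          forall Q : point, h \in denom Q ->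
            exists fQ : f \in denom Q, g Q = stalk_frac a fQ] >].

Lemma stalk_fracD P a a' f f' (fP : f \in denom P) (fP' : f' \in denom P)
    (fP'' : f * f' \in denom P) :
  stalk_frac a fP + stalk_frac a' fP' =
  stalk_frac (fun i => a i * f' + a' i * f) fP''.
Proof.
rewrite /stalk_frac -raddfD; congr tocoker; apply/ffunP => i.
by rewrite !ffunE [LHS]fracD; apply: frac_eq.
Qed.

Lemma stalk_fracZ P s a f (fP : f \in denom P) :
  tolocS P s *: stalk_frac a fP = stalk_frac (fun i => s * a i) fP.
Proof.
rewrite /stalk_frac -linearZ; congr tocoker; apply/ffunP => i.
by rewrite !ffunE [LHS]fracM; apply: frac_eq; rewrite mul1r.
Qed.

Lemma denomM P f g : f * g \in denom P -> Shomog f -> Shomog g ->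
  f \in denom P /\ g \in denom P.
Proof.
move=> /asboolP[_ fgP] hf hg; split; apply/asboolP; split=> // fP; apply: fgP.
  by rewrite mulrC; apply: ptM.
exact: ptM.
Qed.

Lemma is_section_submod z : submod_closed (is_section z).
Proof.
split=> [|c g g' /asboolP sg /asboolP sg']; apply/asboolP => P.
  exists 1, 1, (fun=> 0), 0; split; [exact: rpred1|exact: Sdeg1|..].
    by move=> i; apply: Sdeg0.
  move=> Q h1; exists h1; rewrite /stalk_frac.
  rewrite (_ : [ffun _ => _] = 0) ?raddf0 //.
  apply/ffunP => i; rewrite !ffunE -[RHS](raddf0 (tolocS Q)).
  by apply: frac_eq.
have [h [f [a [d [hP fd ad hQ]]]]] := sg P.
have [h' [f' [a' [d' [hP' fd' ad' hQ']]]]] := sg' P.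
have [hh _] := asboolP _ hP; have [hh' _] := asboolP _ hP'.
exists (h * h'), (f * f'), (fun i => kS c * a i * f' + a' i * f), (d + d').
split; first exact: (rpredM hP hP').
- exact: SdegM.
- move=> i; apply: SdegD.
    rewrite addrA; apply: SdegM fd'.
    by rewrite -[X in Sdeg X]add0r; apply: SdegM (ad i); apply: SdegC.
  by rewrite [d + d']addrC addrA; apply: SdegM fd.
move=> Q /denomM /(_ hh hh')[hhQ hhQ'].
have [fQ e] := hQ Q hhQ; have [fQ' e'] := hQ' Q hhQ'.
exists (rpredM fQ fQ').
rewrite -[LHS]/(tolocS Q (kS c) *: g Q + g' Q) e e' stalk_fracZ; exact: stalk_fracD.
Qed.
HB.instance Definition _ z :=
  GRing.isSubmodClosed.Build k germs (is_section z) (is_section_submod z).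

Definition gsec (z : LL) : Type := {g : germs | g \in is_section z}.
HB.instance Definition _ z := SubChoice.on (gsec z).
HB.instance Definition _ z := [SubChoice_isSubLmodule of gsec z by <:].

(* A morphism from O(x) to an L-graded sheaf of modules is given by a global
   section of degree -x. *)
Definition HomX (x : LL) : lmodType k := gsec (- x).

(* Composition with the map x_i : O(x) -> O(x'), where x' = x + x_i. *)
Definition germs_mul (s : SS) (g : germs) : germs := fun P => tolocS P s *: g P.

Lemma germs_mulP i x x' (g : germs) : x' = x + xv i ->
  g \in is_section (- x') -> germs_mul (xS i) g \in is_section (- x).
Proof.
move=> -> /asboolP sg; apply/asboolP => P.
have [h [f [a [d [hP fd ad hQ]]]]] := sg P.
exists h, f, (fun i0 => xS i * a i0), d; split=> // [j|Q hq].
  rewrite (_ : _ + d = xv i + (y + xv (val j) *+ b (val j) - (x + xv i) + d)).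
    exact: SdegM (Sdegx i) (ad j).
  by rewrite [RHS]addrA; congr (_ + d); rewrite [RHS]addrC opprD addrA addrNK.
have [fQ e] := hQ Q hq; exists fQ.
by rewrite /germs_mul e stalk_fracZ.
Qed.

Definition HomX_pre (i : 'I_t) (x x' : LL) (e : x' = x + xv i)
  (u : HomX x') : HomX x := 
  (exist _ (germs_mul (xS i) (val u)) (germs_mulP e (valP u)) : gsec (- x)).

Lemma HomX_pre_linear i x x' (e : x' = x + xv i) : linear (HomX_pre e).
Proof.
move=> c u v; apply: val_inj; rewrite [RHS]linearP.
rewrite -[LHS]/(germs_mul _ (val (c *: u + v))) linearP.
apply: functional_extensionality_dep => P.
rewrite -[LHS]/(tolocS P (xS i) *: (tolocS P (kS c) *: val u P + val v P)).
rewrite -[RHS]/(tolocS P (kS c) *: (tolocS P (xS i) *: val u P)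
  + tolocS P (xS i) *: val v P).
by rewrite scalerDr !scalerA mulrC.
Qed.
HB.instance Definition _ i x x' (e : x' = x + xv i) :=
  GRing.isLinear.Build k (HomX x') (HomX x) *:%R (HomX_pre e)
    (HomX_pre_linear e).

End CokernelSheaf.

(* The quiver of the canonical algebra: [Vmid i m] is the vertex (m+1) x_i.
   The m-th vertex of the i-th arm, 0 <= m <= p_i, is [vtx i m], and
   [m : 'I_(p i)] numbers the arrow alpha^(i)_(m+1) : vtx i m -> vtx i m.+1. *)
Inductive vertex := V0 | Vmid (i : 'I_t) (m : 'I_(p i).-1) | Vc.

Definition vtx (i : 'I_t) (m : nat) : vertex :=
  if m is m'.+1 then
    if insub m' is Some u then @Vmid i u else Vc
  else V0.

Definition vdeg (v : vertex) : LL :=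
  match v with V0 => 0 | Vmid i m => xv i *+ m.+1 | Vc => cv end.

Lemma vdeg_vtx i m : (m <= p i)%N -> vdeg (vtx i m) = xv i *+ m.
Proof.
case: m => [|m] mp; first by rewrite mulr0n.
rewrite /vtx; case: insubP => [u _ <- //|]; rewrite -leqNgt => h /=.
rewrite (cvE i); congr (_ *+ _); apply/eqP; rewrite eqn_leq mp.
by rewrite -(prednK (ltnW (wt_ge2 i))) ltnS h.
Qed.

Lemma vdeg_arrow i (m : 'I_(p i)) :
  vdeg (vtx i m.+1) = vdeg (vtx i m) + xv i.
Proof. by rewrite !vdeg_vtx ?(ltnW (ltn_ord m)) // mulrSr. Qed.

(* Right modules: contravariant representations of the quiver.  The modules
   over the canonical algebra are those satisfying its relations, which form a
   full subcategory closed under isomorphism. *)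
Record rep := Rep {
  rep_sp :> vertex -> lmodType k;
  rep_mor : forall (i : 'I_t) (m : 'I_(p i)),
    {linear rep_sp (vtx i m.+1) -> rep_sp (vtx i m)} }.

Definition rep_iso (M N : rep) : Prop :=
  exists phi : forall v, {linear M v -> N v},
    (forall v, bijective (phi v)) /\
    forall i (m : 'I_(p i)) (u : M (vtx i m.+1)),
      phi (vtx i m) (rep_mor M m u) = rep_mor N m (phi (vtx i m.+1) u).

(* Hom_X(T, E) for the cokernel E of
   [x_i^(b_i)]_(i in I) : O(y) -> sum_(i in I) O(y + b_i x_i). *)
Definition coker_rep (I : {set 'I_t}) (b : 'I_t -> nat) (y : LL) : rep :=
  @Rep (fun v => HomX I b y (vdeg v))
    (fun i m => HomX_pre (vdeg_arrow m)).

Definition Xmx r s : 'M[k]_(r, s) := \matrix_(i, j) (i == j :> nat)%:R.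
Definition Ymx r s : 'M[k]_(r, s) := \matrix_(i, j) (i == j + (r - s) :> nat)%N%:R.
Definition Zmx r s (l : k) : 'M[k]_(r, s) :=
  \matrix_(i, j) ((i == j :> nat)%:R + l * (i == j.+1 :> nat)%:R).

Section Matrices.
Variables (i1 i2 i3 : 'I_t) (n : nat) (a b : 'I_t -> nat).

(* The three values of the dimension vector: 2n+3, 2n+2 and 2n+1. *)
Inductive level := L3 | L2 | L1.
Definition ldim (l : level) : nat :=
  match l with L3 => n.+1 + n.+2 | L2 => n.+1 + n.+1 | L1 => n + n.+1 end.

(* For i = i3, a_i + b_i - p_i is the number c_i. *)
Definition arm_level (i : 'I_t) (m : nat) : level :=
  if i == i3 then
    if (m <= a i + b i - p i)%N then L3 else if (m <= a i)%N then L2 else L1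
  else if (i == i1) || (i == i2) then
    if (m <= a i)%N then L3 else if (m <= a i + b i)%N then L2 else L1
  else if (m <= a i)%N then L3 else L1.

Definition vlevel (v : vertex) : level :=
  match v with V0 => L3 | Vmid i m => arm_level i m.+1 | Vc => L1 end.

Definition XYmx (i : 'I_t) r s : 'M[k]_(r, s) :=
  if i == arm2 then Ymx r s else Xmx r s.

Definition first_mx (i : 'I_t) (l : level) : 'M[k]_(ldim l) :=
  match l with
  | L3 => if (2 <= i)%N
          then block_mx (Zmx n.+1 n.+1 (lam i)) 0 0 (Zmx n.+2 n.+2 (lam i))
          else 1%:M
  | _ => 1%:M
  end.

(* The matrix of an arrow of the i-th arm, except for the factor [first_mx]: the
   arrows along which the level changes are those numbered a_i + 1 and
   a_i + b_i + 1 for i = i1, i2, those numbered c_i + 1 and a_i + 1 for i = i3,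
   and the one numbered a_i + 1 for the other arms.  The level never increases
   along an arm, so the last case does not occur. *)
Definition step_mx (i : 'I_t) (l l' : level) : 'M[k]_(ldim l, ldim l') :=
  match l, l' with
  | L3, L3 => 1%:M
  | L2, L2 => 1%:M
  | L1, L1 => 1%:M
  | L3, L2 =>
      if i == i1 then
        block_mx (- 1%:M) 0 (Zmx n.+2 n.+1 (- lam i3)) (XYmx i n.+2 n.+1)
      else block_mx 1%:M 0 0 (XYmx i n.+2 n.+1)
  | L2, L1 =>
      if i == i1 then
        block_mx (- XYmx i n.+1 n) 0 (Zmx n.+1 n (- lam i3)) 1%:M
      else block_mx (XYmx i n.+1 n) 0 0 1%:M
  | L3, L1 => block_mx (XYmx i n.+1 n) 0 0 (XYmx i n.+2 n.+1)
  | _, _ => 0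
  end.

Definition arrow_mx (i : 'I_t) (m : 'I_(p i)) :
    'M[k]_(ldim (vlevel (vtx i m)), ldim (vlevel (vtx i m.+1))) :=
  let M := step_mx i (vlevel (vtx i m)) (vlevel (vtx i m.+1)) in
  if m == 0%N :> nat then first_mx i (vlevel (vtx i m)) *m M else M.

Definition matrix_rep : rep :=
  @Rep (fun v => 'cV[k]_(ldim (vlevel v))) (fun i m => mulmx (arrow_mx m)).

End Matrices.

End WeightedProjectiveLine.

(* Main.v *)
(* Sections of the cokernel over X agree generically, so they are elements of the
   generic stalk which lie in every stalk.  The denominators of such an element
   form a graded ideal contained in no point, hence one containing powers of x_1
   and x_2, and the vanishing of H^1(O(y - x)) for 0 <= x <= c turns the element
   into a class of the cokernel of S_(y-x) -> sum_i S_(y+b_i x_i-x).  Every S_z is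
   a space of polynomials of bounded degree: it is x^r times binary forms in
   x_1^(p_1) and x_2^(p_2).  At the vertex 0 the cokernel is thus k^(n+1) + k^(n+2).
   All arrows of both representations are injective, so it remains to compare,
   inside this space, the images of the vertices of each arm. *)
Require Import Defs.
From HB Require Import structures.
From mathcomp Require Import all_boot all_order all_algebra.
From mathcomp Require Import generic_quotient ring_quotient ring zify.
From mathcomp Require Import boolp ssrcomplements mpoly.
From mathcomp Require classical_sets.
Import Order.TTheory GRing.Theory Num.Theory.
Local Open Scope ring_scope.
Local Open Scope quotient_scope.

Set Implicit Arguments.
Unset Strict Implicit.
Unset Printing Implicit Defensive.

(** * The group L and the graded pieces of S *)

(** Dehomogenizing by x_1^(p_1) -> 1 has a price: divisibility by x_1^(p_1) is visible only as a
    drop in size. Hence size bounds accompany every divisibility statement, and the regular sequence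
    behind torsion-freeness is taken from the arms i2 and i3, since i1 may be the first arm. In the
    middle of the arm i1 only the first component is not forced to be divisible by ell_(i1). In
    coordinates (U, V) at the vertex 0 the image is therefore a congruence between V and a multiple
    of U modulo ell_(i1). The given matrices also cut out such a congruence, but with another
    constant. The factor [rescale], put into the coordinate V, makes the two agree; on the other
    arms the conditions on V do not change under scaling. *)

Section GradedRing.
Variables (k : fieldType) (W : weights k).
Local Notation t := (nb W).
Local Notation p := (@wt k W).
Local Notation A := {mpoly k[t]}.
Local Notation LL := (LL W).
Local Notation SS := (SS W).

Lemma sum_delta (R : pzRingType) (I : finType) (j : I) (F : I -> R) :
  \sum_i (i == j)%:R * F i = F j.
Proof.
rewrite (bigD1 j) //= eqxx mul1r big1 ?addr0 // => i /negPf ->.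
by rewrite mul0r.
Qed.

Lemma wt_gt0 i : (0 < p i)%N.
Proof. exact: leq_trans (wt_ge2 i). Qed.

Lemma toL_eq (u v : Lfree W) : toL u = toL v -> Lrel (u - v).
Proof.
move=> e; move/eqP: e; rewrite /toL => e.
by have := e; rewrite -[_ == _]/(_ ==
  _ :> Quotient.quot (GRing.ZmodClosed.clone (Lfree W) (@Lrel k W) _))
  -Quotient.idealrBE.
Qed.

Lemma toLE (v : Lfree W) : toL v = \sum_i xv i *~ v 0 i.
Proof.
rewrite {1}(row_sum_delta v) raddf_sum; apply: eq_bigr => i _.
by rewrite /xv -raddfMz -scaler_int intz.
Qed.

(** The generator of index i adds p_i times its coefficient to entry i and takes p_1 times that
    coefficient from entry 1; subtracting the sum of all coefficients at entry 1 makes the quotients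
    sum to zero. *)
Lemma Lrel_entries (u : Lfree W) : Lrel u ->
  exists2 q : 'I_t -> int, \sum_i q i = 0 & forall i, u 0 i = (p i)%:Z * q i.
Proof.
move=> /asboolP[m ->].
exists (fun i => m i - (i == arm1 W)%:R * \sum_j m j).
  by rewrite sumrB sum_delta subrr.
move=> i; rewrite summxE.
transitivity (\sum_j ((i == j)%:R * (p i)%:Z * m j
    - (i == arm1 W)%:R * (p (arm1 W))%:Z * m j)).
  apply: eq_bigr => j _; rewrite -scaler_int mxE /Lgen !mxE !mulmxnE !mxE !eqxx /=.
  rewrite intz -[_ *+ p j]mulr_natr -[_ *+ p (arm1 W)]mulr_natr (natz (p j)).
  rewrite (natz (p (arm1 W))).
  by case: (eqVneq i j) => [->|_]; rewrite ?mulr1n ?mulr0n; ring.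
rewrite sumrB -mulr_sumr.
under eq_bigr => j _ do rewrite eq_sym -mulrA.
rewrite sum_delta; case: eqVneq => [->|_] /=; ring.
Qed.

(** This determines S_z: the space has dimension l + 1 for l >= 0 and vanishes for l < 0. *)
Definition normal_form (z : LL) (r : 'I_t -> nat) (l : int) : Prop :=
  (forall i, r i < p i)%N /\ z = \sum_i xv i *+ r i + cv W *~ l.

Lemma mdegLE (m : 'X_{1..t}) : mdegL m = toL (\row_i (m i)%:Z).
Proof. by rewrite toLE; apply: eq_bigr => i _; rewrite mxE. Qed.

Lemma nf_toL z r l : normal_form z r l ->
  z = toL (\row_i ((r i)%:Z + (i == arm1 W)%:R * (p i)%:Z * l)).
Proof.
move=> [_ ->]; rewrite toLE; under [RHS]eq_bigr => i _ do rewrite mxE mulrzDr.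
rewrite big_split /=; congr (_ + _).
rewrite (bigD1 (arm1 W)) // eqxx mul1r big1 /= ?addr0 ?mulrzA //.
by move=> i /negPf ->; rewrite !mul0r.
Qed.

(** The relations of L only move multiples of the p_i between entries, with quotients of total zero;
    so r_i is the remainder of m_i by p_i and l collects the quotients. *)
Lemma nf_mdegL m z r l : mdegL m = z -> normal_form z r l ->
  (forall i, m i %% p i = r i)%N /\ (\sum_i (m i %/ p i)%N)%:Z = l.
Proof.
move=> mz nfz; have rp := nfz.1.
have := nf_toL nfz; rewrite -mz mdegLE => /toL_eq/Lrel_entries[q q0 qE].
pose s i := q i + (i == arm1 W)%:R * l.
have sE i : (m i)%:Z = (r i)%:Z + (p i)%:Z * s i.
  by have := qE i; rewrite !mxE => /eqP; rewrite subr_eq => /eqP ->; rewrite /s;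
    ring.
have sm i : s i = (m i %/ p i)%N /\ (m i %% p i)%N = r i.
  have pi0 := wt_gt0 i; case: (s i) (sE i) => [d|d].
    rewrite -PoszM -PoszD => -[->]; rewrite addnC mulnC.
    by rewrite divnMDl // modnMDl modn_small // divn_small // addn0.
  (* A negative quotient contradicts m_i >= 0 and r_i < p_i. *)
  move=> h; exfalso; have /eqP e : (m i)%:Z + (p i)%:Z * d.+1%:Z = (r i)%:Z.
    by rewrite h NegzE; ring.
  move: e (rp i); rewrite -PoszM -PoszD eqz_nat => /eqP <-.
  by rewrite mulnS addnCA -[X in (_ < X)%N]addn0 ltn_add2l.
split=> [i|]; first by case: (sm i).
rewrite -[LHS]/(Posz _) (big_morph Posz PoszD (erefl _)).
by rewrite -(eq_bigr _ (fun i _ => (sm i).1)) big_split /= q0 add0r sum_delta.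
Qed.

Lemma nf_exists z : exists r l, normal_form z r l.
Proof.
have [v ->] : exists v : Lfree W, z = toL v.
  exists (repr (z : Quotient.quot (GRing.ZmodClosed.clone (Lfree W) (@Lrel k W)
    _))).
  by rewrite /toL reprK.
have p0 i : (p i)%:Z != 0 by rewrite -lt0n wt_gt0.
exists (fun i => absz (v 0%R i %% p i)%Z), (\sum_i (v 0%R i %/ p i)%Z); split.
  by move=> i; rewrite -ltz_nat gez0_abs ?modz_ge0 ?ltz_pmod ?ltz_nat ?wt_gt0.
rewrite toLE -[\sum_i xv i *+ _ in RHS]/(_) mulrz_sumr -big_split /=.
apply: eq_bigr => i _; rewrite (cvE i) pmulrn gez0_abs ?modz_ge0 //.
rewrite [X in _ + X *~ _]pmulrn -mulrzA -mulrzDr.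
by rewrite {1}(divz_eq (v 0 i) (p i)) addrC mulrC.
Qed.

Lemma nf_addc z r l j : normal_form z r l -> normal_form (z + cv W *~ j) r (l + j).
Proof. by move=> [rp ->]; split=> //; rewrite -addrA mulrzDr. Qed.

Lemma nf_addx z r l i b : normal_form z r l ->
  normal_form (z + xv i *+ b) (fun j => if j == i then (r i + b) %% p i else r j)%N
     (l + ((r i + b) %/ p i)%N%:Z).
Proof.
move=> [rp ->]; split=> [j|].
  by case: eqVneq => [->|_]; rewrite ?ltn_mod ?wt_gt0.
rewrite mulrzDr addrA [LHS]addrAC [RHS]addrAC; congr (_ + _).
rewrite (bigD1 i) //= [in RHS](bigD1 i) //= eqxx (cvE i).
rewrite [X in _ = _ + X + _](eq_bigr (fun j => xv j *+ r j)); last first.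
  by move=> j /negPf ->.
rewrite addrAC [RHS]addrAC; congr (_ + _); rewrite -pmulrn -mulrnA -!mulrnDr.
by rewrite {1}(divn_eq (r i + b) (p i)) mulnC addnC.
Qed.

(** Subtracting m x_i is adding (p_i - m) x_i and then -c; for m <= r_i the addition carries exactly
    once, and the carry cancels -c. *)
Lemma nf_subx z r l i m : normal_form z r l -> (m <= r i)%N ->
  normal_form (z - xv i *+ m) (fun j => if j == i then r i - m else r j)%N l.
Proof.
move=> nfz mr; have := nf_addc (-1) (nf_addx i (p i - m) nfz).
have mp : (m <= p i)%N by apply: leq_trans mr (ltnW (nfz.1 i)).
have -> : (r i + (p i - m) = r i - m + p i)%N by rewrite addnBA // addnBAC.
rewrite modnDr divnDr ?dvdnn // divnn wt_gt0.
have rp : (r i - m < p i)%N by apply: leq_ltn_trans (leq_subr _ _) (nfz.1 i).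
rewrite modn_small // divn_small // add0n addrK mulrN1z (cvE i) mulrnBr //.
by rewrite addrA addrAC addrK.
Qed.

Lemma nf_subx_carry z r l i m : normal_form z r l -> (r i < m <= p i)%N ->
  normal_form (z - xv i *+ m) (fun j => if j ==
    i then r i + (p i - m) else r j)%N (l - 1).
Proof.
move=> nfz /andP[rm mp]; have := nf_addc (-1) (nf_addx i (p i - m) nfz).
have rp : (r i + (p i - m) < p i)%N by lia.
rewrite modn_small // divn_small // addr0 mulrN1z (cvE i) mulrnBr //.
by rewrite addrA addrAC addrK.
Qed.

End GradedRing.

(** * Dehomogenization to polynomials in one variable *)

Section Dehomogenization.
Variables (k : fieldType) (W : weights k).
Local Notation t := (nb W).
Local Notation p := (@wt k W).
Local Notation A := {mpoly k[t]}.
Local Notation LL := (LL W).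
Local Notation SS := (SS W).

(* x_i^(p_i), written as a binary form in x_1^(p_1) and x_2^(p_2) and
   dehomogenized by x_1^(p_1) -> 1, x_2^(p_2) -> 'X. *)
Definition ell (i : 'I_t) : {poly k} :=
  if i == arm1 W then 1 else if i == arm2 W then 'X else 1 + lam i *: 'X.

Definition ellmon (m : 'X_{1..t}) : {poly k} := \prod_i ell i ^+ (m i %/ p i).

(** Discarding the monomials of other degrees makes this linear on all of A, so that it descends to
    S without a homogeneity condition. *)
Definition dehomA (z : LL) (f : A) : {poly k} :=
  \sum_(m <- msupp f) ((mdegL m == z)%:R * f@_m) *: ellmon m.

Lemma dehomA_bnd z (f : A) d : (msize f <= d)%N ->
  dehomA z f = \sum_(m : 'X_{1..t < d}) ((mdegL m == z)%:R * f@_m) *: ellmon m.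
Proof.
move=> le_fd; rewrite /dehomA (big_mksub ('X_{1..t < d} :
  subFinType _)) ?msupp_uniq //=; first last.
  by move=> m /msize_mdeg_lt /leq_trans; apply.
by rewrite big_rmcond //= => m /memN_msupp_eq0 ->; rewrite mulr0 scale0r.
Qed.

Lemma dehomA_linear z : linear (dehomA z).
Proof.
move=> c f g; pose d := (msize f + msize g + msize (c *: f + g))%N.
rewrite !(@dehomA_bnd z _ d) ?/d ?leq_addl //; last first.
- by rewrite -addnA leq_addr.
- by rewrite addnAC leq_addl.
rewrite scaler_sumr -big_split; apply: eq_bigr => m _ /=.
by rewrite mcoeffD mcoeffZ mulrDr scalerDl scalerA mulrCA.
Qed.
HB.instance Definition _ z := GRing.isLinear.Build k A {poly k} *:%R (dehomA z)
  (dehomA_linear z).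

Lemma dehomAX z m : dehomA z 'X_[m] = (mdegL m == z)%:R *: ellmon m.
Proof. by rewrite /dehomA msuppX big_seq1 mcoeffX eqxx mulr1. Qed.

Lemma ellmon_addx m i : ellmon (m + U_(i) *+ p i) = ellmon m * ell i.
Proof.
rewrite /ellmon (bigD1 i) //= [in RHS](bigD1 i) //= mulrAC; congr (_ * _).
  rewrite mnmDE mulmnE mnm1E eqxx mul1n divnDr ?dvdnn // divnn wt_gt0 addn1.
  by rewrite exprSr.
by apply: eq_bigr => j /negPf ji; rewrite mnmDE mulmnE mnm1E eq_sym ji mul0n addn0.
Qed.

Lemma mdegLD m m' : mdegL (m + m') = mdegL m + mdegL m' :> LL.
Proof.
by rewrite /mdegL -big_split; apply: eq_bigr => i _; rewrite mnmDE mulrnDr.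
Qed.

Lemma mdegLU i b : mdegL (U_(i) *+ b) = xv i *+ b :> LL.
Proof.
rewrite /mdegL (bigD1 i) // mulmnE mnm1E eqxx mul1n big1 /=
  ?addr0 // => j /negPf ji.
by rewrite mulmnE mnm1E eq_sym ji.
Qed.

Lemma arm12 : (arm1 W == arm2 W) = false. Proof. by []. Qed.

Lemma ell_arm1 : ell (arm1 W) = 1. Proof. by rewrite /ell eqxx. Qed.
Lemma ell_arm2 : ell (arm2 W) = 'X.
Proof. by rewrite /ell eq_sym arm12 eqxx. Qed.
Lemma ell_ge2 (i : 'I_t) : (2 <= i)%N -> ell i = 1 + lam i *: 'X.
Proof. by rewrite /ell -!val_eqE /=; case: (val i) => [|[|?]]. Qed.

(** A monomial multiple of a relation has its three terms in one degree, where it contributes a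
    multiple of ell_i - 1 - lam_i X = 0. *)
Lemma dehomA_Srel z f : Srel f -> dehomA z f = 0.
Proof.
move=> /asboolP[q ->]; rewrite raddf_sum big1 // => i i2.
rewrite (mpolyE (q i)) mulr_suml raddf_sum big1 //= => m _.
rewrite -scalerAl linearZ /= [X in _ *: X](_ : _ = 0) ?scaler0 //.
rewrite /Sgen !mulrBr -scalerAr !linearB linearZ /= !mpolyXn -!mpolyXD !dehomAX.
rewrite !ellmon_addx !mdegLD !mdegLU -!cvE ell_arm1 ell_arm2 ell_ge2 //.
rewrite -!mul_polyC; ring.
Qed.

Lemma toS_eq0 (f : A) : toS f = 0 -> Srel f.
Proof.
move=> /eqP; rewrite -(raddf0 (@toS k W)) /toS => h.
have := h; rewrite -[_ == _]/(_ ==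
  _ :> {ideal_quot (Idealr.clone A (@Srel k W) _)}).
by rewrite -Quotient.idealrBE subr0.
Qed.

Definition Srepr (s : SS) : A := repr (s :
  {ideal_quot (Idealr.clone A (@Srel k W) _)}).
Lemma SreprK s : toS (Srepr s) = s.
Proof. by rewrite /toS /Srepr reprK. Qed.

Definition dehom (z : LL) (s : SS) : {poly k} := dehomA z (Srepr s).

Lemma dehom_toS z f : dehom z (toS f) = dehomA z f.
Proof.
apply/eqP; rewrite -subr_eq0 -raddfB /=; apply/eqP/dehomA_Srel/toS_eq0.
by rewrite raddfB /= SreprK subrr.
Qed.

Lemma dehomB z : zmod_morphism (dehom z).
Proof.
by move=> s s'; rewrite -(SreprK s) -(SreprK s') -raddfB !dehom_toS raddfB.
Qed.
HB.instance Definition _ z :=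
  GRing.isZmodMorphism.Build SS {poly k} (dehom z) (dehomB z).

Lemma dehomZ z c s : dehom z (@kS k W c * s) = c *: dehom z s.
Proof. by rewrite -(SreprK s) -rmorphM mul_mpolyC !dehom_toS linearZ. Qed.

End Dehomogenization.

(** * Homogeneous pieces of S as spaces of polynomials of bounded size *)

Section GradedPieces.
Variables (k : fieldType) (W : weights k).
Local Notation t := (nb W).
Local Notation p := (@wt k W).
Local Notation A := {mpoly k[t]}.
Local Notation LL := (LL W).
Local Notation SS := (SS W).
Local Notation xS := (@xS k W).
Local Notation Sdeg := (@Sdeg k W).

Definition mnmbase := (@mnmDE t, @mnmBE t, @mulmnE t, @mnm1E t, @mnmE t).

Lemma ell_neq0 i : @ell k W i != 0.
Proof.
rewrite /ell; case: ifP => _; first exact: oner_neq0.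
case: ifP => _; first by rewrite polyX_eq0.
apply/eqP => /(congr1 (fun q : {poly k} => q`_0)) /eqP.
by rewrite coefD coef1 coefZ coefX mulr0 addr0 coef0 oner_eq0.
Qed.

Lemma size_ell i : (size (@ell k W i) <= 2)%N.
Proof.
rewrite /ell; case: ifP => _; first by rewrite size_poly1.
case: ifP => _; first by rewrite size_polyX.
rewrite (leq_trans (size_polyD _ _)) // geq_max size_poly1.
by rewrite (leq_trans (size_scale_leq _ _)) ?size_polyX.
Qed.

(* Number of coefficients of a binary form of degree l. *)
Definition psize (l : int) : nat := if l is Posz d then d.+1 else 0.

Definition formmon (r : 'I_t -> nat) (l j : nat) : 'X_{1..t} :=
  ([multinom r i | i < t] + U_(arm1 W) *+ (p (arm1 W) * (l - j))
     + U_(arm2 W) *+ (p (arm2 W) * j))%MM.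

(** Rehomogenization, inverse to [dehom] on polynomials of size at most l + 1; higher coefficients
    are dropped, hence the size hypotheses below. *)
Definition form (r : 'I_t -> nat) (l : nat) (F : {poly k}) : A :=
  \sum_(j < l.+1) F`_j *: 'X_[formmon r l j].

Lemma form_linear r l : linear (form r l).
Proof.
move=> c F G; rewrite /form scaler_sumr -big_split; apply: eq_bigr => j _ /=.
by rewrite coefD coefZ scalerDl scalerA.
Qed.
HB.instance Definition _ r l := GRing.isLinear.Build k {poly k} A *:%R (form r l)
  (form_linear r l).

Lemma form_mul1 r l (F : {poly k}) : (size F <= l.+1)%N ->
  'X_(arm1 W) ^+ p (arm1 W) * form r l F = form r l.+1 F.
Proof.
move=> sF; rewrite /form [RHS]big_ord_recr /= (nth_default 0 sF) scale0r addr0.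
rewrite mulr_sumr; apply: eq_bigr => j _; rewrite -scalerAr mpolyXn -mpolyXD.
congr (_ *: 'X_[_]); apply/mnmP => i.
rewrite /formmon !mnmbase subSn ?(leq_ord j) // mulnS; lia.
Qed.

Lemma form_mul2 r l F :
  'X_(arm2 W) ^+ p (arm2 W) * form r l F = form r l.+1 (F * 'X).
Proof.
rewrite /form [RHS]big_ord_recl /= coefMX eqxx scale0r add0r.
rewrite mulr_sumr; apply: eq_bigr => j _; rewrite -scalerAr mpolyXn -mpolyXD.
rewrite coefMX /=; congr (_ *: 'X_[_]); apply/mnmP => i.
by rewrite /formmon !mnmbase /bump add1n subSS mulnS; lia.
Qed.

Lemma xS_wt (i : 'I_t) : (2 <= i)%N -> xS i ^+ p i =
  xS (arm1 W) ^+ p (arm1 W) + @kS k W (lam i) * xS (arm2 W) ^+ p (arm2 W).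
Proof.
move=> i2; apply/eqP; rewrite -subr_eq0 opprD addrA /xS /kS -!rmorphXn -rmorphM.
rewrite mul_mpolyC -!raddfB /= -/(Sgen i); apply/eqP.
rewrite -(raddf0 (@toS k W)); apply/eqP.
rewrite -[_ == _]/(_ == _ :> {ideal_quot (Idealr.clone A (@Srel k W) _)}).
rewrite -Quotient.idealrBE subr0; apply/asboolP.
exists (fun j => (j == i)%:R).
rewrite (bigD1 i) //= eqxx mul1r big1 ?addr0 // => j /andP[_ /negPf ->].
exact: mul0r.
Qed.

Lemma form_mul i r l (F : {poly k}) : (size F <= l.+1)%N ->
  toS ('X_i ^+ p i * form r l F) = toS (form r l.+1 (F * ell i)).
Proof.
move=> sF; case: (ltnP i 2) => [|i2]; last first.
  rewrite rmorphM rmorphXn /= -[toS 'X_i]/(xS i) xS_wt // ell_ge2 //.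
  rewrite mulrDr mulr1 -scalerAr linearD linearZ /= -form_mul1 // -form_mul2.
  by rewrite mulrDl -!rmorphXn -!rmorphM /= -mulrA mul_mpolyC -raddfD.
rewrite ltnS leq_eqVlt ltnS leqn0 => /orP[] /eqP i_eq.
  have -> : i = arm2 W by apply: val_inj.
  by rewrite ell_arm2 form_mul2.
have -> : i = arm1 W by apply: val_inj.
by rewrite ell_arm1 mulr1 form_mul1.
Qed.

Lemma size_mul_ell (F : {poly k}) i l : (size F <= l)%N ->
  (size (F * @ell k W i)%R <= l.+1)%N.
Proof.
move=> sF; have [->|F0] := eqVneq F 0; first by rewrite mul0r size_poly0.
rewrite size_mul ?ell_neq0 // -subn1 leq_subLR add1n -addn2.
exact: leq_add sF (size_ell i).
Qed.

(** Induction on the number of factors x_i^(p_i): each one is traded for its linear form [ell i],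
    and the remainders stay as exponents. *)
Lemma toS_mon d (m : 'X_{1..t}) : (\sum_i m i %/ p i)%N = d ->
  (size (@ellmon k W m) <= d.+1)%N /\
  toS 'X_[m] = toS (form (fun i => m i %% p i)%N d (ellmon m)).
Proof.
elim: d m => [|d IH] m md.
  have {}md i : (m i %/ p i = 0)%N.
    by apply/eqP; rewrite -leqn0 -md (bigD1 i) //= leq_addr.
  have e1 : @ellmon k W m = 1.
    by rewrite /ellmon big1 // => i _; rewrite md expr0.
  rewrite e1 size_poly1; split=> //.
  rewrite /form big_ord1 coef1 eqxx scale1r; congr (toS 'X_[_]); apply/mnmP => i.
  rewrite /formmon !mnmbase subnn !muln0 !addn0 modn_small //.
  by rewrite (divn_eq (m i) (p i)) md mul0n ltn_mod wt_gt0.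
have [i mi] : exists i, (0 < m i %/ p i)%N.
  apply/existsP; apply: contra_eqT md; rewrite negb_exists => /forallP h.
  rewrite big1 // => i _; apply/eqP; rewrite -leqn0 leqNgt; exact: h.
have pm : (p i <= m i)%N by rewrite -divn_gt0 ?wt_gt0.
have [m' mE] : exists m', m = (m' + U_(i) *+ p i)%MM.
  exists (m - U_(i) *+ p i)%MM; apply/mnmP => j; rewrite !mnmbase; case:
    eqP => [<-|_]; rewrite ?mul1n ?mul0n; lia.
have m'd : (\sum_j m' j %/ p j)%N = d.
  apply: succn_inj; rewrite -md (bigD1 i) //= [in RHS](bigD1 i) //= mE -addSn.
  congr (_ + _)%N.
    by rewrite !mnmbase eqxx mul1n divnDr ?dvdnn // divnn wt_gt0 addn1.
  by apply: eq_bigr => j /negPf ji; rewrite !mnmbase eq_sym ji mul0n addn0.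
have [s' e'] := IH m' m'd; rewrite mE ellmon_addx; split.
  exact: size_mul_ell.
have -> : (fun j => (m' + U_(i) *+ p i)%MM j %% p j)%N = (fun j => m' j %% p j)%N.
  apply: funext => j; rewrite !mnmbase.
  by case: eqP => [<-|_]; rewrite ?mul1n ?mul0n ?modnDr ?addn0.
rewrite -form_mul // addmC mpolyXD -mpolyXn.
by rewrite [LHS]rmorphM [RHS]rmorphM /= e'.
Qed.

Lemma Sdeg_sum z (I : Type) (s : seq I) (P : pred I) (F : I -> SS) :
  (forall i, P i -> Sdeg z (F i)) -> Sdeg z (\sum_(i <- s | P i) F i).
Proof. by move=> h; elim/big_ind: _ => //; [exact: Sdeg0|exact: SdegD]. Qed.

Lemma SdegZ z c s : Sdeg z s -> Sdeg z (@kS k W c * s).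
Proof. by rewrite -[z in X in _ -> X]add0r; apply: SdegM; apply: SdegC. Qed.

Lemma SdegX m : Sdeg (mdegL m) (toS 'X_[m]).
Proof. by exists 'X_[m] => // m'; rewrite msuppX inE => /eqP ->. Qed.

Lemma SdegN z s : Sdeg z s -> Sdeg z (- s).
Proof.
move=> h; rewrite -mulN1r -cS1 -[- _](raddfN (@toS k W)) -[- _%:MP](raddfN
  (@mpolyC t k)).
exact: SdegZ.
Qed.

Lemma SdegB z s s' : Sdeg z s -> Sdeg z s' -> Sdeg z (s - s').
Proof. by move=> h h'; apply: SdegD => //; apply: SdegN. Qed.

Lemma mdegL_formmon z r l j : normal_form z r l%:Z -> (j <= l)%N ->
  mdegL (formmon r l j) = z.
Proof.
move=> [_ ->] jl; rewrite !mdegLD !mdegLU !mulrnA -!cvE -addrA -mulrnDr subnK //.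
congr (_ + _); apply: eq_bigr => i _; by rewrite mnmE.
Qed.

Lemma ellmon_formmon z r l j : normal_form z r l%:Z -> ellmon (formmon r l j) =
  'X^j :> {poly k}.
Proof.
move=> [rp _].
have h m i d : ellmon (m + U_(i) *+ (p i * d)) = ellmon m * @ell k W i ^+ d.
  elim: d => [|d IH]; first by rewrite muln0 mulm0n addm0 expr0 mulr1.
  rewrite exprSr mulrA -IH -ellmon_addx; congr ellmon; apply/mnmP => i'.
  by rewrite !mnmbase mulnS mulnDr -addnA [(_ * (_ * d) + _)%N]addnC.
rewrite /formmon !h.
rewrite ell_arm1 ell_arm2 expr1n mulr1 /ellmon big1 ?mul1r // => i _.
by rewrite mnmE divn_small ?expr0.
Qed.

Lemma Sdeg_form z r l F : normal_form z r l%:Z -> Sdeg z (toS (form r l F)).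
Proof.
move=> nfz; rewrite raddf_sum; apply: Sdeg_sum => j _ /=.
rewrite -mul_mpolyC rmorphM; apply: SdegZ.
by rewrite -(mdegL_formmon nfz (leq_ord j)); apply: SdegX.
Qed.

Lemma dehom_form z r l (F : {poly k}) : normal_form z r l%:Z -> (size F <=
  l.+1)%N ->
  dehom z (toS (form r l F)) = F.
Proof.
move=> nfz sF; rewrite dehom_toS raddf_sum /= -[RHS](coefK F).
rewrite (poly_def (size F)) (big_ord_widen _ (fun i => F`_i *: 'X^i) sF).
rewrite [RHS]big_mkcond; apply: eq_bigr => j _ /=.
rewrite linearZ /= dehomAX (mdegL_formmon nfz (leq_ord j)) eqxx scale1r.
rewrite (ellmon_formmon _ nfz); case: ltnP => // h.
by rewrite nth_default // scale0r.
Qed.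

Lemma Sdeg_formE z r l s : normal_form z r l%:Z -> Sdeg z s ->
  exists2 F : {poly k}, (size F <= l.+1)%N & s = toS (form r l F).
Proof.
move=> nfz [f fz ->]; rewrite (mpolyE f) big_seq.
elim/big_ind: _ => [|g h [F sF eF] [G sG eG]|m mf].
- by exists 0; rewrite ?size_poly0 // linear0.
- exists (F + G); last by rewrite linearD !raddfD /= eF eG.
  by rewrite (leq_trans (size_polyD _ _)) // geq_max sF sG.
have [m1 [m2]] := nf_mdegL (fz m mf) nfz; have [sm em] := toS_mon m2.
exists (f@_m *: ellmon m); first exact: leq_trans (size_scale_leq _ _) sm.
rewrite linearZ /= -!mul_mpolyC !rmorphM /= em; congr (_ * toS (form _ _ _)).
exact: funext.
Qed.

Lemma Sdeg_neg z r d s : normal_form z r (Negz d) -> Sdeg z s -> s = 0.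
Proof.
move=> nfz [f fz ->]; rewrite (mpolyE f) big_seq big1 ?raddf0 // => m mf.
(* A monomial of degree z would make the negative coefficient of c a sum of natural quotients. *)
by have [] := nf_mdegL (fz m mf) nfz.
Qed.

Lemma dehom_size z r l s : normal_form z r l -> Sdeg z s ->
  (size (dehom z s) <= psize l)%N.
Proof.
case: l => l nfz sz; last by rewrite (Sdeg_neg nfz sz) raddf0 size_poly0.
by have [F sF ->] := Sdeg_formE nfz sz; rewrite (dehom_form nfz).
Qed.

Lemma dehom_eq0 z s : Sdeg z s -> dehom z s = 0 -> s = 0.
Proof.
have [r [[l|l] nfz]] := nf_exists z => sz; last by rewrite (Sdeg_neg nfz sz).
have [F sF ->] := Sdeg_formE nfz sz; rewrite (dehom_form nfz) // => ->.
by rewrite !raddf0.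
Qed.

Lemma dehom_inj z s s' : Sdeg z s -> Sdeg z s' -> dehom z s = dehom z s' -> s = s'.
Proof.
move=> sz sz' e; apply/eqP; rewrite -subr_eq0; apply/eqP.
by apply: (@dehom_eq0 z); [exact: SdegB|rewrite raddfB /= e subrr].
Qed.

Lemma dehom_surj z r l (F : {poly k}) : normal_form z r l -> (size F <=
  psize l)%N ->
  exists2 s, Sdeg z s & dehom z s = F.
Proof.
case: l => l nfz sF; last first.
  exists 0; first exact: Sdeg0.
  by rewrite raddf0; apply/esym/eqP; rewrite -size_poly_leq0.
by exists (toS (form r l F)); [exact: Sdeg_form nfz|exact: dehom_form].
Qed.

Lemma dehom_other z z' s : Sdeg z s -> z != z' -> dehom z' s = 0.
Proof.
move=> [f fz ->] /negPf zz'; rewrite dehom_toS /dehomA big_seq big1 // => m mf.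
by rewrite (fz m mf) zz' mul0r scale0r.
Qed.

(** When r_i + r'_i reaches p_i, a factor x_i^(p_i) is released; it shows up as the extra
    [ell i]. *)
Lemma dehomM z r l z' r' l' s s' : normal_form z r l -> normal_form z' r' l' ->
  Sdeg z s -> Sdeg z' s' ->
  dehom (z + z') (s * s') =
    (\prod_i ell i ^+ ((r i + r' i) %/ p i)) * dehom z s * dehom z' s'.
Proof.
move=> nfz nfz' [f fz ->] [g gz ->]; rewrite -rmorphM /= !dehom_toS.
rewrite {1}(mpolyE f) {1}(mpolyE g) [X in dehomA _ (X * _)]big_seq.
rewrite [X in dehomA _ (_ * X)]big_seq mulr_suml raddf_sum /=.
rewrite [dehomA z f]/dehomA [dehomA z' g]/dehomA [X in _ =
  _ * X * _]big_seq [X in _ = _ * X]big_seq.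
rewrite -mulrA mulr_suml [RHS]mulr_sumr; apply: eq_bigr => m mf.
rewrite !mulr_sumr raddf_sum; apply: eq_bigr => m' mg /=.
rewrite (fz m mf) (gz m' mg) !eqxx !mul1r -!scalerAr -!scalerAl scalerA -mpolyXD.
rewrite linearZ /= dehomAX mdegLD (fz m mf) (gz m' mg) eqxx scale1r.
rewrite -scalerAr scalerA; congr (_ *: _); rewrite /ellmon -!big_split; apply:
  eq_bigr => i _ /=; rewrite -!exprD.
congr (_ ^+ _); rewrite mnmDE.
have [<- _] := nf_mdegL (fz m mf) nfz; have [<- _] := nf_mdegL (gz m' mg) nfz'.
rewrite {1}(divn_eq (m i) (p i)) {1}(divn_eq (m' i) (p i)) addnACA -mulnDl.
by rewrite divnMDl ?wt_gt0 // addnC addnA.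
Qed.

Lemma Sdeg_mul_eq0 z z' s s' : Sdeg z s -> Sdeg z' s' -> s * s' = 0 ->
  s = 0 \/ s' = 0.
Proof.
move=> sz sz'; have [r [l nfz]] := nf_exists z; have [r' [l' nfz']] := nf_exists z'.
move=> /(congr1 (dehom (z + z'))); rewrite (dehomM nfz nfz') // raddf0 => /eqP.
rewrite !mulf_eq0 prodf_seq_eq0 -orbA => /orP[/hasP[i _]|/orP[/eqP|/eqP]].
- by rewrite expf_eq0 (negPf (ell_neq0 i)) andbF.
- by move/(dehom_eq0 sz); left.
- by move/(dehom_eq0 sz'); right.
Qed.

Lemma Sdeg_mulI z z' h s s' : Sdeg z h -> h != 0 -> Sdeg z' s -> Sdeg z' s' ->
  h * s = h * s' -> s = s'.
Proof.
move=> hz h0 sz sz' /eqP; rewrite -subr_eq0 -mulrBr => /eqP.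
case/(Sdeg_mul_eq0 hz (SdegB sz sz')) => [/eqP|/eqP]; first by rewrite (negPf h0).
by rewrite subr_eq0 => /eqP.
Qed.

Lemma SdegXn i b : Sdeg (xv i *+ b) (xS i ^+ b).
Proof. by rewrite -mdegLU /xS -rmorphXn /= mpolyXn; apply: SdegX. Qed.

Lemma xSn_neq0 i b : xS i ^+ b != 0.
Proof.
apply/eqP => /(congr1 (dehom (xv i *+ b))); rewrite /xS -rmorphXn /= mpolyXn.
rewrite dehom_toS dehomAX mdegLU eqxx scale1r raddf0 => /eqP.
rewrite prodf_seq_eq0 => /hasP[j _].
by rewrite expf_eq0 (negPf (ell_neq0 j)) andbF.
Qed.

Lemma dehom_mulx z r l i b s : normal_form z r l -> Sdeg z s ->
  dehom (z + xv i *+ b) (xS i ^+ b * s) = ell i ^+ ((r i + b) %/ p i) * dehom z s.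
Proof.
move=> nfz [f fz ->]; rewrite /xS -rmorphXn -rmorphM /= !dehom_toS.
rewrite {1}(mpolyE f) [dehomA z f]/dehomA !big_seq !mulr_sumr raddf_sum.
apply: eq_bigr => m mf /=; rewrite mpolyXn (fz m mf) eqxx mul1r -!scalerAr -mpolyXD.
rewrite linearZ /= dehomAX mdegLD mdegLU (fz m mf) [_ + z]addrC eqxx scale1r.
congr (_ *: _); rewrite /ellmon (bigD1 i) //= [in RHS](bigD1 i) //= mulrA.
congr (_ * _); last first.
  by apply: eq_bigr => j /negPf ji; rewrite !mnmbase eq_sym ji mul0n.
rewrite -exprD !mnmbase eqxx mul1n; congr (_ ^+ _).
have [<- _] := nf_mdegL (fz m mf) nfz.
by rewrite {1}(divn_eq (m i) (p i)) addnCA divnMDl ?wt_gt0 // addnC [(b +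
  _)%N]addnC.
Qed.

(** Every element of S_z is a multiple of x_i^(r_i); for b > r_i a further x_i^(p_i) has to split
    off the binary form. On the first arm, where [ell i] is 1, the size bound on G is the whole
    condition. *)
Lemma Sdeg_divx z r l i b s : normal_form z r l -> (b <= p i)%N -> Sdeg z s ->
  (b <= r i)%N \/ (exists2 G : {poly k}, (size G <= psize (l - 1))%N & dehom z s =
    ell i * G) ->
  exists2 u, Sdeg (z - xv i *+ b) u & s = xS i ^+ b * u.
Proof.
move=> nfz bp sz; have e : z - xv i *+ b + xv i *+ b = z by rewrite subrK.
suff [r' [l' [normal_form' h]]] : exists r' l', normal_form (z - xv i *+ b) r' l' 
    /\ ((b <= r i)%N \/ (exists2 G : {poly k}, (size G <= psize (l - 1))%N &
      dehom z s = ell i * G) ->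
     exists2 G : {poly k}, (size G <= psize l')%N & dehom z s =
       ell i ^+ ((r' i + b) %/ p i) * G).
  move=> /h[G sG eG]; have [u uz uG] := dehom_surj normal_form' sG; exists u => //.
  apply: (@dehom_inj z) => //; first by rewrite -e addrC; apply: SdegM => //;
    apply: SdegXn.
  by have := dehom_mulx i b normal_form' uz; rewrite e uG => ->.
have rp := nfz.1 i.
case: (leqP b (r i)) => br.
  exists (fun j => if j == i then r i - b else r j)%N, l; split; first exact:
    nf_subx.
  move=> _; exists (dehom z s); first exact: dehom_size nfz sz.
  by rewrite eqxx subnK // divn_small // mul1r.
exists (fun j => if j == i then r i + (p i - b) else r j)%N, (l - 1); split.
  by apply: nf_subx_carry; rewrite ?br.
case=> [//|[G sG eG]]; exists G => //; rewrite eG eqxx -addnA subnK //.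
by rewrite divnDr ?dvdnn // divnn wt_gt0 divn_small // expr1.
Qed.

End GradedPieces.

(** * Regular sequences, stalks and points *)

Section Regularity.
Variables (k : fieldType) (W : weights k).
Local Notation t := (nb W).
Local Notation p := (@wt k W).
Local Notation LL := (LL W).
Local Notation SS := (SS W).
Local Notation xS := (@xS k W).
Local Notation Sdeg := (@Sdeg k W).

Lemma size_ell_neq1 i : i != arm1 W -> size (@ell k W i) = 2.
Proof.
move=> i1; rewrite /ell (negPf i1); case: eqP => [_|/eqP i2]; first exact:
  size_polyX.
have l0 : lam i != 0.
  by apply: lam_neq0; move: i1 i2; rewrite -!val_eqE /=; case: (val i) => [|[|?]].
by rewrite addrC size_polyDl size_scale // size_polyX ?size_poly1.
Qed.

(** Off the first arm the roots are distinct: 0 for the second arm, -1/lam_i for the others. *)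
Lemma coprimep_ell i j : i != j -> coprimep (@ell k W i) (ell j).
Proof.
wlog ij : i j / (i < j)%N => [hw ij|_].
  by case: (ltngtP i j) => [/hw->|/hw h|/val_inj/eqP];
    rewrite ?(negPf ij) // coprimep_sym h // eq_sym.
have [->|i1] := eqVneq i (arm1 W); first by rewrite ell_arm1 coprime1p.
have j2 : (2 <= j)%N.
  by move: i1 ij; rewrite -val_eqE /=; case: (val i) => // n _; apply:
    leq_ltn_trans.
rewrite (ell_ge2 j2); have [->|i2] := eqVneq i (arm2 W).
  rewrite ell_arm2 coprimep_sym coprimepX /root hornerD hornerZ hornerX hornerC.
  by rewrite mulr0 addr0 oner_eq0.
have {i1}i2 : (2 <= i)%N.
  by move: i1 i2; rewrite -!val_eqE /=; case: (val i) => [|[|?]].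
rewrite ell_ge2 //; apply/Bezout_coprimepP; exists ((lam j)%:P, - (lam i)%:P) => /=.
have -> : (lam j)%:P * (1 + lam i *: 'X) + - (lam i)%:P * (1 + lam j *: 'X) =
  (lam j - lam i)%:P by rewrite -!mul_polyC polyCB; ring.
rewrite -size_poly_eq1 size_polyC subr_eq0.
by case: (eqVneq (lam j)) => // e; have e' := lam_inj j2 i2 e;
  rewrite e' ltnn in ij.
Qed.

(** If adding bi to the remainder of w does not carry, x_i^bi divides a for degree reasons. If it
    carries, [ell i] divides a power of [ell j] times the polynomial of a, hence the latter by
    coprimality; on the first arm, with [ell i] = 1, this would be empty. *)
Lemma xSn_regular i j bi bj w a a' : i != arm1 W -> i != j -> (bi < p i)%N ->
  Sdeg (w + xv i *+ bi) a -> Sdeg (w + xv j *+ bj) a' ->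
  xS j ^+ bj * a = xS i ^+ bi * a' ->
  exists2 d, Sdeg w d & a = xS i ^+ bi * d.
Proof.
move=> i1 ij bip da da' e; have [r [l nfw]] := nf_exists w.
rewrite -[X in Sdeg X](addrK (xv i *+ bi) w).
apply: (Sdeg_divx (nf_addx i bi nfw) (ltnW bip) da).
rewrite eqxx; case: (ltnP (r i + bi) (p i)) => [h|h].
  by left; rewrite modn_small // leq_addl.
right; have e1 : ((r i + bi) %/ p i = 1)%N.
  by apply/eqP; rewrite eqn_leq -ltnS ltn_divLR ?wt_gt0 // leq_divRL ?wt_gt0 //;
    have := nfw.1 i; lia.
have h2 : ell i %| dehom (w + xv i *+ bi) a.
  have := dehom_mulx i bi (nf_addx j bj nfw) da'.
  rewrite -e (negPf ij) e1 expr1 addrAC (dehom_mulx j bj (nf_addx i bi nfw) da).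
  move=> /(congr1 (fun q : {poly k} => ell i %| q)).
  by rewrite dvdp_mulIl Gauss_dvdpr // coprimep_expr ?coprimep_ell.
exists (dehom (w + xv i *+ bi) a %/ ell i); last by rewrite mulrC divpK.
rewrite size_divp ?ell_neq0 // size_ell_neq1 // e1 subn1.
have := dehom_size (nf_addx i bi nfw) da; rewrite e1 addrK.
case: l {nfw} => [d|[|d]] /=; case: (size _) => //= n; first by rewrite addn1.
Qed.

(** Eliminating c between the components i and j and cancelling h gives x_j^(b_j) a_i = x_i^(b_i)
    a_j, and regularity yields d. The other components follow because nonzero homogeneous elements
    can be cancelled. *)
Lemma coker_torsion_free (I : {set 'I_t}) (b : 'I_t -> nat) w v h c
    (i j : {l : 'I_t | l \in I}) (a : {l : 'I_t | l \in I} -> SS) :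
  val i != arm1 W -> val i != val j -> (b (val i) < p (val i))%N ->
  (forall l, Sdeg (w + xv (val l) *+ b (val l)) (a l)) ->
  Sdeg v h -> h != 0 ->
  (forall l, h * a l = xS (val l) ^+ b (val l) * c) ->
  exists2 d, Sdeg w d & forall l, a l = xS (val l) ^+ b (val l) * d.
Proof.
move=> i1 ij bi da dh h0 hc.
have degx l m s z : Sdeg z s -> Sdeg (z + xv l *+ m) (xS l ^+ m * s).
  by move=> ?; rewrite addrC; apply: SdegM => //; apply: SdegXn.
have [d dd ei] : exists2 d, Sdeg w d & a i = xS (val i) ^+ b (val i) * d.
  apply: (@xSn_regular (val i) (val j) (b (val i)) (b (val j)) w _ (a j));
    [by []|by []|by []|exact: da|exact: da|].
  apply: (Sdeg_mulI dh h0); [exact/degx/da|rewrite addrAC; exact/degx/da|].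
  by rewrite mulrCA hc // [RHS]mulrCA hc // mulrCA.
exists d => // l; apply: (@Sdeg_mulI k W (xv (val i) *+ b (val i)) (w + xv (val l)
  *+ b (val l)) (xS (val i) ^+ b (val i))).
- exact: SdegXn.
- exact: xSn_neq0.
- exact: da.
- exact: degx.
apply: (@Sdeg_mulI k W v (w + xv (val l) *+ b (val l) + xv (val i) *+ b (val i))
  h) => //.
- exact/degx/da.
- exact/degx/degx.
rewrite mulrCA hc // [xS (val i) ^+ _ * (_ * d)]mulrCA -ei [RHS]mulrCA hc // mulrCA.
by [].
Qed.

End Regularity.

Section Localization.
Variables (R : comNzRingType) (M : mulrClosed R).

Lemma frac_eqP (a b f g : R) (fM : f \in M) (gM : g \in M) :
  Defs.frac a fM = Defs.frac b gM -> exists2 h, h \in M & h * (a * g - b * f) = 0.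
Proof.
move=> /eqP e; have : loc_eq (a, exist _ f fM) (b, exist _ g gM).
  by rewrite -[X in is_true X]/(loc_equiv M _ _) -eqmodE.
by move/asboolP.
Qed.

Lemma frac_ex (x : loc M) : exists a f (fM : f \in M), x = Defs.frac a fM.
Proof.
by elim/quotW: x => -[a [f fM]]; exists a, f, fM.
Qed.

End Localization.

(** * Stalks of the cokernel and the generic point *)

Section Sheaf.
Variables (k : fieldType) (W : weights k).
Local Notation t := (nb W).
Local Notation p := (@wt k W).
Local Notation LL := (LL W).
Local Notation SS := (SS W).
Local Notation xS := (@xS k W).
Local Notation Sdeg := (@Sdeg k W).

Section Cokernel.
Variables (I : {set 'I_t}) (b : 'I_t -> nat).
Local Notation J := {l : 'I_t | l \in I}.
Variables (i j : J) (i1 : val i != arm1 W) (ij : val i != val j)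
  (bi : (b (val i) < p (val i))%N).

Definition bdry (w : LL) (a : J -> SS) : Prop :=
  exists2 d, Sdeg w d & forall l, a l = xS (val l) ^+ b (val l) * d.

Lemma denomP (P : point W) f : f \in denom P -> (exists v, Sdeg v f) /\ f != 0.
Proof.
move=> /asboolP[hf fP]; split=> //; apply/eqP => f0; apply: fP; rewrite f0.
exact: pt0.
Qed.

(** Torsion-freeness removes both the point and the denominator from the condition, so the
    homogeneous parts of all stalks embed in the generic one. *)
Lemma stalk_frac_eq0 (P : point W) w a f (fP : f \in denom P) :
  (forall l, Sdeg (w + xv (val l) *+ b (val l)) (a l)) ->
  stalk_frac b a fP = 0 <-> bdry w a.
Proof.
move=> da; split=> [/tocoker_eq0[c]|[d dd ad]]; last first.
  apply/tocoker_eq0; exists (fracS d fP); apply/ffunP => l; rewrite !ffunE.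
  by rewrite ad -[RHS]/(Defs.frac _ _ * Defs.frac _ _) fracM; apply: frac_eq;
    rewrite mul1r.
have [e [g [gP ->]]] := frac_ex c => /ffunP ec.
have [[vf df] f0] := denomP fP; have [[vg dg] g0] := denomP gP.
have /choice[h hP] : forall l, exists h, h \in denom P /\
    h * (g * a l) = h * (xS (val l) ^+ b (val l) * (f * e)).
  move=> l; have := ec l; rewrite !ffunE -[RHS]/(Defs.frac _ _ * Defs.frac _ _)
    fracM.
  case/frac_eqP=> h hP /eqP; rewrite mulrBr subr_eq0 mul1r => /eqP eh.
  exists h; split; first exact: hP.
  by rewrite [g * _]mulrC eh [f * e]mulrC -[_ * e * f]mulrA.
(* One multiplier for all components at once; it is nonzero because it lies outside P. *)
have [[vh dh] h0] : (exists v, Sdeg v (\prod_l h l)) /\ \prod_l h l != 0.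
  apply: (@denomP P); apply: rpred_prod => l _.
  by have [] := hP l.
apply: (coker_torsion_free i1 ij bi da (SdegM dh dg) (c := \prod_l h l * (f * e))).
  by apply/eqP => /(Sdeg_mul_eq0 dh dg)[/eqP|/eqP]; apply/negP.
move=> l; have [_ e1] := hP l; rewrite (bigD1 l) //= -!mulrA.
by rewrite [LHS]mulrCA e1 [RHS]mulrCA [LHS]mulrCA [in LHS](mulrCA (\prod_(i0 | _)
  _)).
Qed.

Lemma stalk_frac_eq (P : point W) w v v' a f a' f' (fP : f \in denom P)
    (fP' : f' \in denom P) : Sdeg v f -> Sdeg v' f' ->
  (forall l, Sdeg (w + xv (val l) *+ b (val l) + v) (a l)) ->
  (forall l, Sdeg (w + xv (val l) *+ b (val l) + v') (a' l)) ->
  stalk_frac b a fP = stalk_frac b a' fP' <->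
  bdry (w + v + v') (fun l => a l * f' - a' l * f).
Proof.
move=> df df' da da'.
have deg l : Sdeg (w + v + v' + xv (val l) *+ b (val l)) (a l * f' - a' l * f).
  rewrite addrAC [w + v + _]addrAC; apply: SdegB; first exact: SdegM.
  by rewrite addrAC; apply: SdegM.
have ffP : f * f' \in denom P by apply: rpredM.
rewrite -(stalk_frac_eq0 ffP deg).
have -> : stalk_frac b (fun l => a l * f' - a' l * f) ffP =
  stalk_frac b a fP - stalk_frac b a' fP'.
  rewrite /stalk_frac -raddfB; congr tocoker; apply/ffunP => l; rewrite !ffunE.
  rewrite -[RHS]/(Defs.frac _ _ - Defs.frac _ _) fracN fracD.
  by apply: frac_eq; rewrite mulNr.
by split=> [->|/eqP]; rewrite ?subrr // subr_eq0 => /eqP.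
Qed.

Lemma generic_point_prime (a c : SS) : Shomog a -> Shomog c -> a * c = 0 ->
  a = 0 \/ c = 0.
Proof. by move=> [z az] [v cv]; apply: Sdeg_mul_eq0 az cv. Qed.

(** Left transparent, since [generic_denom] has to see that the ideal is zero. *)
Definition generic_point : point W.
Proof.
refine (@Point k W (fun s => s = 0) erefl _ _ _ generic_point_prime _).
- by move=> a c -> ->; rewrite addr0.
- by move=> c a ->; rewrite mulr0.
- by move=> a ->; exists [::]; rewrite ?big_nil.
- by exists (arm1 W); apply/eqP; rewrite -[xS _]expr1; apply: xSn_neq0.
Defined.

Lemma generic_denom v f : Sdeg v f -> f != 0 -> f \in denom generic_point.
Proof. by move=> df /eqP f0; apply/asboolP; split=> //; exists v. Qed.

End Cokernel.
End Sheaf.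

(** * Graded ideals and graded primes *)

Section GradedIdeals.
Variables (k : fieldType) (W : weights k).
Local Notation t := (nb W).
Local Notation p := (@wt k W).
Local Notation LL := (LL W).
Local Notation SS := (SS W).
Local Notation xS := (@xS k W).
Local Notation Sdeg := (@Sdeg k W).

Definition gideal (Q : SS -> Prop) : Prop :=
  [/\ Q 0, forall a c, Q a -> Q c -> Q (a + c), forall c a, Q a -> Q (c * a) &
      forall a, Q a -> exists2 r : seq SS,
        forall c, c \in r -> Q c /\ Shomog c & a = \sum_(c <- r) c].

Lemma Shomog_sum (s : SS) : exists2 r : seq SS,
  forall c, c \in r -> Shomog c & s = \sum_(c <- r) c.
Proof.
rewrite -(SreprK s); set f := Srepr s.
exists [seq toS (f@_m *: 'X_[m]) | m <- msupp f].
  move=> _ /mapP[m _ ->]; exists (mdegL m); rewrite -mul_mpolyC rmorphM.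
  exact/SdegZ/SdegX.
by rewrite big_map -raddf_sum -mpolyE.
Qed.

Lemma gideal_addl Q a : gideal Q -> Shomog a ->
  gideal (fun s => exists q u, Q q /\ s = q + a * u).
Proof.
move=> [Q0 QD QM Qh] [v da]; split.
- by exists 0, 0; rewrite mulr0 addr0.
- move=> _ _ [q [u [qQ ->]]] [q' [u' [qQ' ->]]]; exists (q + q'), (u + u').
  by split; [exact: QD|ring].
- move=> c _ [q [u [qQ ->]]]; exists (c * q), (c * u).
  by split; [exact: QM|ring].
move=> _ [q [u [qQ ->]]]; have [r hr ->] := Qh _ qQ; have [r' hr' ->] :=
  Shomog_sum u.
exists (r ++ [seq a * c | c <- r']); last by rewrite big_cat big_map mulr_sumr.
move=> c; rewrite mem_cat => /orP[/hr[cQ ch]|/mapP[d /hr'[v' dd] ->]].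
  by split=> //; exists c, 0; rewrite mulr0 addr0.
by split; [exists 0, d; rewrite add0r|exists (v + v'); exact: SdegM].
Qed.

(** Krull's argument in graded form: an ideal maximal among the graded ideals that contain D and no
    power of x is prime for homogeneous elements. *)
Lemma graded_prime_avoiding (D : SS -> Prop) (x : SS) : gideal D ->
  (forall n, ~ D (x ^+ n)) ->
  exists Q, [/\ gideal Q, forall s, D s -> Q s, ~ Q x &
    forall a c, Shomog a -> Shomog c -> Q (a * c) -> Q a \/ Q c].
Proof.
move=> gD Dx.
pose good (Q : SS -> Prop) := gideal Q /\ forall n, ~ Q (x ^+ n).
(* Zorn's lemma is applied to sets A through their union with D, so that the empty chain yields D
   itself. *)
pose DU (A : classical_sets.set SS) s := D s \/ A s.
have [F FP Ftot|A [[gA xA] Amax]] :=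
  @classical_sets.Zorn_bigcup SS (fun A => good (DU A)).
  set G := DU _.
  have GD s : D s -> G s by left.
  have GA A s : F A -> DU A s -> G s by move=> FA [?|?]; [left|right; exists A].
  have G1 s : G s -> exists B, [/\ good B, B s & forall s', B s' -> G s'].
    move=> [Ds|[A FA As]]; first by exists D; split.
    by exists (DU A); split; [exact: FP|right|move=> s'; exact: GA].
  have G2 s u : G s -> G u -> exists B, [/\ good B, B s, B u & forall s', B s' ->
    G s'].
    move=> [Ds|[A FA As]] Gu.
      have [B [gB Bu BG]] := G1 u Gu.
      move: Gu => [Du|[A FA Au]]; first by exists D; split.
      by exists (DU A); split; [exact: FP|left|right|move=> s'; exact: GA].
    move: Gu => [Du|[A' FA' Au]].
      by exists (DU A); split; [exact: FP|right|left|move=> s'; exact: GA].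
    case: (Ftot A A' FA FA') => sub.
      by exists (DU A'); split; [exact: FP|right; exact: sub|right|move=> s';
        exact: GA].
    by exists (DU A); split; [exact: FP|right|right; exact: sub|move=> s'; exact:
      GA].
  split; last first.
    by move=> n /G1[B [[_ Bx] /Bx]].
  split.
  - by left; have [] := gD.
  - by move=> a c /G2 h /h[B [[[_ BD _ _] _] Ba Bc BG]]; apply/BG/BD.
  - by move=> c a /G1[B [[[_ _ BM _] _] Ba BG]]; apply/BG/BM.
  move=> a /G1[B [[[_ _ _ Bh] _] Ba BG]]; have [r hr ->] := Bh a Ba.
  by exists r => // c /hr[/BG].
exists (DU A); split=> //; [by left|by have := xA 1|].
have [Q0 QD QM Qh] := gA.
(* By maximality, the ideal generated by [DU A] and a contains a power of x; it is graded because a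
   is homogeneous. *)
have step a : Shomog a -> ~ DU A a -> exists n q u, DU A q /\ x ^+ n = q + a * u.
  move=> ha nQa; have gB := gideal_addl gA ha; apply: contrapT => nB.
  apply: (Amax (fun s => exists q u, DU A q /\ s = q + a * u)).
    split; last first.
      move=> /(_ a) h; apply: nQa; right; apply: h; exists 0, 1.
      by rewrite mulr1 add0r.
    by move=> s As; exists s, 0; rewrite mulr0 addr0; split=> //; right.
  rewrite (_ : DU _ = (fun s => exists q u, DU A q /\ s = q + a * u)).
    by split=> // n; apply: contra_not nB => -[q [u h]]; exists n, q, u.
  apply/funext => s; apply/propext; split; last by right.
  by case=> // Ds; exists s, 0; rewrite mulr0 addr0; split=> //; left.
move=> a c ha hc Qac; apply: contrapT => /not_orP[/(step a ha)[n [q [u [qQ e]]]]].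
move=> /(step c hc)[m [q' [u' [qQ' e']]]]; apply: (xA (n + m)%N).
have -> : x ^+ (n + m) = (q' + c * u') * q + ((a * u) * q' + (u * u') * (a * c)).
  by rewrite exprD e e'; ring.
by apply: (QD); [exact: QM|apply: QD; exact: QM].
Qed.

(** Otherwise some graded prime contains all D v and no power of x_i; missing x_i, it is a point,
    and the last hypothesis fails there. *)
Lemma power_in_graded_ideal (D : LL -> SS -> Prop) i :
  (forall v s, D v s -> Sdeg v s) -> (forall v, D v 0) ->
  (forall v s s', D v s -> D v s' -> D v (s + s')) ->
  (forall v v' c s, Sdeg v' c -> D v s -> D (v' + v) (c * s)) ->
  (forall P : point W, exists v s, s \in denom P /\ D v s) ->
  exists n, D (xv i *+ n) (xS i ^+ n).
Proof.
move=> Ddeg D0 DD DM DP.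
pose E s := exists2 r : seq (LL * SS), forall e, e \in r -> D e.1 e.2 &
  s = \sum_(e <- r) e.2.
have ED a c : E a -> E c -> E (a + c).
  move=> [r hr ->] [r' hr' ->]; exists (r ++ r'); last by rewrite big_cat.
  by move=> e; rewrite mem_cat => /orP[/hr|/hr'].
have E0 : E 0 by exists [::]; rewrite ?big_nil.
have gE : gideal E.
  split=> // [c a Ea|a [r hr ->]].
    have [r hr ->] := Shomog_sum c; rewrite mulr_suml big_seq.
    elim/big_ind: _ => // d /hr[v dv]; have [r' hr' ->] := Ea.
    exists [seq (v + e.1, d * e.2) | e <- r']; last by rewrite big_map mulr_sumr.
    by move=> _ /mapP[e /hr' De ->]; exact: DM.
  exists [seq e.2 | e <- r]; last by rewrite big_map.
  move=> _ /mapP[e er ->]; split; last by exists e.1; apply/Ddeg/hr.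
  by exists [:: e]; rewrite ?big_seq1 // => e'; rewrite inE => /eqP ->; apply: hr.
have [[n [r hr e]]|nE] := pselect (exists n, E (xS i ^+ n)).
  (* The power is so far a sum of elements of various D v; being homogeneous, it equals the partial
     sum of its own degree. *)
  exists n; pose s := \sum_(e <- r | e.1 == xv i *+ n) e.2.
  have Ds : D (xv i *+ n) s.
    rewrite /s big_seq_cond; elim/big_ind: _ => // [? ?|e' /andP[/hr h /eqP <-] //].
    exact: DD.
  suff -> : xS i ^+ n = s by [].
  apply: (dehom_inj (SdegXn i n) (Ddeg _ _ Ds)); rewrite e /s !raddf_sum /=.
  rewrite [RHS]big_mkcond big_seq [RHS]big_seq; apply: eq_bigr => e' /hr/Ddeg de.
  by case: eqVneq => // ne; apply: dehom_other de ne.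
have [|Q [[Q0 QD QM Qh] EQ Qx Qp]] := graded_prime_avoiding gE (x := xS i).
  by move=> n En; apply: nE; exists n.
pose P := Point Q0 QD QM Qh Qp (ex_intro _ i Qx).
have [v [s [/asboolP[_ sP] Ds]]] := DP P; case: sP; apply: EQ.
by exists [:: (v, s)]; rewrite ?big_seq1 // => e; rewrite inE => /eqP ->.
Qed.

End GradedIdeals.

(** * Global sections of the cokernel *)

Section GlobalSections.
Variables (k : fieldType) (W : weights k).
Local Notation t := (nb W).
Local Notation p := (@wt k W).
Local Notation LL := (LL W).
Local Notation SS := (SS W).
Local Notation xS := (@xS k W).
Local Notation Sdeg := (@Sdeg k W).

Lemma psize_sub l n : (psize (l + n%:Z) - n <= psize l)%N.
Proof. by rewrite /psize; case: l => l; case E: (_ + _) => [d|d] //; lia. Qed.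

Lemma psize_ge l n : -1 <= l -> (n <= psize (l + n%:Z))%N.
Proof. by rewrite /psize; case: l => l; case E: (_ + _) => [d|d] //; lia. Qed.

Lemma xS_wtX i n : Sdeg (cv W *+ n) (xS i ^+ (p i * n)).
Proof. by rewrite (cvE i) -mulrnA; apply: SdegXn. Qed.

Lemma dehom_wtX i z n s : Sdeg z s ->
  dehom (z + cv W *+ n) (xS i ^+ (p i * n) * s) = ell i ^+ n * dehom z s.
Proof.
move=> dz; have [r [l nfz]] := nf_exists z; rewrite (cvE i) -mulrnA.
by rewrite (dehom_mulx i _ nfz dz) addnC mulnC divnMDl ?wt_gt0 // divn_small
  ?nfz.1 // addn0.
Qed.

(* The Cech cohomology group H^1(O(w)) of the cover {x_1 <> 0}, {x_2 <> 0} vanishes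
   when the coefficient of c in w is at least -1. *)
Lemma Sdeg_split w r l n d : normal_form w r l -> -1 <= l ->
  Sdeg (w + cv W *+ n + cv W *+ n) d ->
  exists d1 d2, [/\ Sdeg (w + cv W *+ n) d1, Sdeg (w + cv W *+ n) d2 &
    d = xS (arm1 W) ^+ (p (arm1 W) * n) * d1 + xS (arm2 W) ^+ (p (arm2 W) * n) *
      d2].
Proof.
move=> nfw l1 dd; pose F := dehom (w + cv W *+ n + cv W *+ n) d.
have nf1 : normal_form (w + cv W *+ n) r (l + n%:Z) by exact: (nf_addc n%:Z).
have nf2 : normal_form (w + cv W *+ n + cv W *+ n) r (l + n%:Z + n%:Z) by exact:
  (nf_addc n%:Z).
have sF : (size F <= psize (l + n%:Z + n%:Z))%N by exact: dehom_size nf2 dd.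
(* The lowest n coefficients go to x_1 and the rest, a multiple of 'X^n, to x_2; the former fit into
   the smaller degree because l >= -1. *)
have [|d1 dd1 F1] := dehom_surj nf1 (F := take_poly n F).
  exact: leq_trans (size_take_poly _ _) (psize_ge _ l1).
have [|d2 dd2 F2] := dehom_surj nf1 (F := drop_poly n F).
  by rewrite size_drop_poly (leq_trans (leq_sub2r _ sF)) // psize_sub.
exists d1, d2; split=> //; apply: (dehom_inj dd).
  by apply: SdegD; rewrite addrC; apply: SdegM => //; apply: xS_wtX.
rewrite raddfD /= !dehom_wtX // F1 F2 ell_arm1 ell_arm2 expr1n mul1r mulrC.
by rewrite poly_take_drop.
Qed.

(** The H^0 counterpart: the polynomial of u2 is 'X^n times that of u1, so the size bound on u2
    leaves u1 a bound smaller by n, which is divisibility by x_1^(p_1 n). *)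
Lemma Sdeg_glue w n u1 u2 : Sdeg (w + cv W *+ n) u1 -> Sdeg (w + cv W *+ n) u2 ->
  xS (arm2 W) ^+ (p (arm2 W) * n) * u1 = xS (arm1 W) ^+ (p (arm1 W) * n) * u2 ->
  exists2 s, Sdeg w s & u1 = xS (arm1 W) ^+ (p (arm1 W) * n) * s /\
    u2 = xS (arm2 W) ^+ (p (arm2 W) * n) * s.
Proof.
move=> du1 du2 /(congr1 (dehom (w + cv W *+ n + cv W *+ n))).
rewrite !dehom_wtX // ell_arm1 ell_arm2 expr1n mul1r => e.
have [r [l nfw]] := nf_exists w.
have nf1 : normal_form (w + cv W *+ n) r (l + n%:Z) by exact: (nf_addc n%:Z).
have [|s ds es] := dehom_surj nfw (F := dehom (w + cv W *+ n) u1).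
  have := dehom_size nf1 du2; rewrite -e.
  have [->|u0] := eqVneq (dehom (w + cv W *+ n) u1) 0; first by rewrite size_poly0.
  rewrite mulrC size_mulXn // => h; apply: leq_trans (psize_sub l n).
  by rewrite leq_subRL ?(leq_trans (leq_addr _ _) h).
have dx i : Sdeg (w + cv W *+ n) (xS i ^+ (p i * n) * s).
  by rewrite addrC; apply: SdegM => //; apply: xS_wtX.
exists s => //; split; apply: (dehom_inj _ (dx _)) => //; rewrite dehom_wtX // es.
  by rewrite ell_arm1 expr1n mul1r.
by rewrite ell_arm2.
Qed.

Section Cokernel.
Variables (I : {set 'I_t}) (b : 'I_t -> nat).
Local Notation J := {l : 'I_t | l \in I}.
Variables (i j : J) (i1 : val i != arm1 W) (ij : val i != val j)
  (bi : (b (val i) < p (val i))%N).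

Lemma denom1 (P : point W) : 1 \in denom P.
Proof. exact: rpred1. Qed.

Lemma section_global (y z : LL) r l (g : germs I b) : normal_form (y + z) r l ->
  -1 <= l ->
  g \in is_section y z ->
  exists2 a : J -> SS, (forall q, Sdeg (y + z + xv (val q) *+ b (val q)) (a q)) &
    forall P, g P = stalk_frac b a (denom1 P).
Proof.
move=> nfw l1 /asboolP sg; pose w := y + z.
have beta (q : J) z' s : Sdeg z' s ->
  Sdeg (z' + xv (val q) *+ b (val q)) (xS (val q) ^+ b (val q) * s).
  by move=> ?; rewrite addrC; apply: SdegM => //; apply: SdegXn.
(* The reference fraction a0 / f0, with which all local fractions are compared. *)
have [h0 [f0 [a0 [d0 [h0P df0 da0 hg0]]]]] := sg (generic_point W).
have [f0g e0] := hg0 _ h0P.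
have {}da0 q : Sdeg (w + xv (val q) *+ b (val q) + d0) (a0 q).
  by rewrite /w (addrAC y z); apply: da0.
have [_ f0n] := denomP f0g.
have loc P : exists f a d, exists fP : f \in denom P, [/\ Sdeg d f,
    forall q, Sdeg (w + xv (val q) *+ b (val q) + d) (a q),
    g P = stalk_frac b a fP & bdry b (w + d0 + d) (fun q => a0 q * f - a q * f0)].
  have [h [f [a [d [hP df da hQ]]]]] := sg P.
  have [fP eP] := hQ P hP; have [[vh dh] hn] := denomP hP.
  (* Every neighbourhood contains the generic point, so the comparison can be made there. *)
  have [fg eg] := hQ _ (generic_denom dh hn).
  have {}da q : Sdeg (w + xv (val q) *+ b (val q) + d) (a q).
    by rewrite /w (addrAC y z); apply: da.
  exists f, a, d, fP; split=> //.
  by apply/(stalk_frac_eq i1 ij bi f0g fg df0 df da0 da); rewrite -e0.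
(* The elements s for which s times the section is given by a tuple u without denominator. *)
pose D v s := Sdeg v s /\ exists2 u : J -> SS,
  forall q, Sdeg (w + xv (val q) *+ b (val q) + v) (u q) &
  bdry b (w + d0 + v) (fun q => a0 q * s - u q * f0).
have DM v v' c s : Sdeg v' c -> D v s -> D (v' + v) (c * s).
  move=> dc [ds [u du [e de he]]]; split; first exact: SdegM.
  exists (fun q => c * u q) => [q|]; first by rewrite addrCA; apply: SdegM.
  exists (c * e) => [|q]; first by rewrite addrCA; apply: SdegM.
  by rewrite mulrCA [RHS]mulrCA -he; ring.
have Dpow q : exists n, D (xv q *+ n) (xS q ^+ n).
  apply: (power_in_graded_ideal (D := D)) => [v s []//|v|v s s'|v v' c s|P].
  - split; first exact: Sdeg0.
    exists (fun=> 0) => [q'|]; first exact: Sdeg0.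
    by exists 0 => [|q']; [exact: Sdeg0|rewrite !mulr0 mul0r subr0].
  - move=> [ds [u du [e de he]]] [ds' [u' du' [e' de' he']]]; split.
      exact: SdegD.
    exists (fun q' => u q' + u' q') => [q'|]; first exact: SdegD.
    exists (e + e') => [|q']; first exact: SdegD.
    by rewrite [RHS]mulrDr -he -he'; ring.
  - exact: DM.
  have [f [a [d [fP [df da _ hb]]]]] := loc P.
  by exists d, f; split=> //; split=> //; exists a.
(* Both powers are raised to a common degree n c. *)
have [n [DT1 DT2]] : exists n, D (cv W *+ n) (xS (arm1 W) ^+ (p (arm1 W) * n)) /\
    D (cv W *+ n) (xS (arm2 W) ^+ (p (arm2 W) * n)).
  have [n1 D1] := Dpow (arm1 W); have [n2 D2] := Dpow (arm2 W).
  have h q m n' : D (xv q *+ m) (xS q ^+ m) -> (m <= n')%N ->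
    D (cv W *+ n') (xS q ^+ (p q * n')).
    move=> Dm mn; have mp : (m <= p q * n')%N by apply:
      leq_trans mn (leq_pmull _ (wt_gt0 q)).
    rewrite (cvE q) -mulrnA -(subnK mp) exprD mulrnDr; apply: DM => //; exact:
      SdegXn.
  exists (n1 + n2)%N; split; first exact: h D1 (leq_addr _ _).
  exact: h D2 (leq_addl _ _).
have [dT1 [u1 du1 [e1 de1 he1]]] := DT1; have [dT2 [u2 du2 [e2 de2 he2]]] := DT2.
move: dT1 dT2 he1 he2; set T1 := xS _ ^+ _; set T2 := xS _ ^+ _ => dT1 dT2 he1 he2.
(* Both terms represent T1 T2 times the section, so their difference is a boundary; d is the Cech
   cocycle. *)
have [d dd hd] : bdry b (w + cv W *+ n + cv W *+ n) (fun q => T1 * u2 q - T2 * u1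
  q).
  apply: (coker_torsion_free i1 ij bi (h := f0) (c := T2 * e1 - T1 * e2)) => //.
  - move=> q; rewrite [_ + cv W *+ n + _]addrAC [w + _ + _]addrAC [X in Sdeg
    X]addrC.
    by apply: SdegB; apply: SdegM.
  - exact: df0.
  - move=> q; transitivity (T2 * (xS (val q) ^+ b (val q) * e1) - T1 * (xS (val q)
    ^+ b (val q) * e2)).
      by rewrite -he1 -he2; ring.
    ring.
(* Splitting d corrects u1 and u2 by the boundaries of d2 and -d1, after which they glue. *)
have [d1 [d2 [dd1 dd2 ed]]] := Sdeg_split nfw l1 dd.
have glue q : exists s, [/\ Sdeg (w + xv (val q) *+ b (val q)) s &
    u1 q + xS (val q) ^+ b (val q) * d2 = T1 * s].
  have [|||s ds [es _]] := @Sdeg_glue (w + xv (val q) *+ b (val q)) n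
    (u1 q + xS (val q) ^+ b (val q) * d2) (u2 q - xS (val q) ^+ b (val q) * d1).
  - by apply: SdegD => //; rewrite addrAC; apply: beta.
  - by apply: SdegB => //; rewrite addrAC; apply: beta.
  - rewrite -/T1 -/T2; apply/eqP; rewrite -subr_eq0; apply/eqP.
    have := hd q; rewrite ed -/T1 -/T2 => /eqP; rewrite -subr_eq0 => /eqP h.
    by rewrite -[RHS]oppr0 -h; ring.
  by exists s.
have /choice[s hs] := glue; exists s => [q|P]; first by have [] := hs q.
have [f [a [v [fP [df da -> [e de he]]]]]] := loc P.
apply/(stalk_frac_eq i1 ij bi fP (denom1 P) df (Sdeg1 W)) => [//|q|].
  by rewrite addr0; have [] := hs q.
(* The glued tuple is known to be correct only after multiplication by f0 T1. *)
apply: (coker_torsion_free i1 ij bi (h := f0 * T1) (c :=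
  f * e1 - T1 * e - f * f0 * d2)).
- move=> q; rewrite mulr1 addr0; have [dq _] := hs q.
  by rewrite (addrAC w v); apply: SdegB => //; apply: SdegM.
- exact: SdegM df0 dT1.
- by apply/eqP => /(Sdeg_mul_eq0 df0 dT1)[/eqP|/eqP]; apply/negP; rewrite ?xSn_neq0.
move=> q; have [_ es] := hs q.
have E1 := he1 q; have E := he q.
rewrite mulr1.
transitivity (T1 * (a0 q * f - (a0 q * f - a q * f0)) - f0 * f * (T1 * s q));
  first by ring.
rewrite -es E; transitivity (f * (a0 q * T1 - u1 q * f0) 
  - xS (val q) ^+ b (val q) * (T1 * e + f * f0 * d2)); first by ring.
by rewrite E1; ring.
Qed.

End Cokernel.
End GlobalSections.

(** * The matrices as operations on polynomials *)

Section ColumnPolynomials.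
Variable k : fieldType.

Definition cpoly d (c : 'cV[k]_d) : {poly k} := rVpoly c^T.

Lemma cpoly_linear d : linear (@cpoly d).
Proof. by move=> a u v; rewrite /cpoly !linearP. Qed.
HB.instance Definition _ d :=
  GRing.isLinear.Build k 'cV[k]_d {poly k} *:%R (@cpoly d)
  (@cpoly_linear d).

Lemma size_cpoly d (c : 'cV[k]_d) : (size (cpoly c) <= d)%N.
Proof. exact: size_poly. Qed.

Lemma cpoly_inj d : injective (@cpoly d).
Proof. by move=> u v /(can_inj rVpolyK)/trmx_inj. Qed.

Lemma cpoly_surj d (q : {poly k}) : (size q <= d)%N -> exists c : 'cV_d, cpoly c =
  q.
Proof. by move=> sq; exists (poly_rV q)^T; rewrite /cpoly trmxK poly_rV_K. Qed.

Lemma coef_cpoly d (c : 'cV[k]_d) (i : nat) :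
  (cpoly c)`_i = \sum_(j < d) (i == j)%:R * c j 0.
Proof.
rewrite /cpoly coef_rVpoly; case: insubP => [j _ <-|ni].
  by rewrite mxE (bigD1 j) //= eqxx mul1r big1 ?addr0 // => q /negPf qj;
    rewrite eq_sym (val_eqE q j) qj mul0r.
rewrite big1 // => j _; case: eqP => [e|]; last by rewrite mul0r.
by rewrite e ltn_ord in ni.
Qed.

Lemma cpoly_mulmx r s (M : 'M_(r, s)) (F : nat -> nat -> k) (c : 'cV_s) (i : nat) :
  (forall i j, M i j = F i j) ->
  (cpoly (M *m c))`_i = if (i < r)%N then \sum_(j < s) F i j * c j 0 else 0.
Proof.
move=> MF; rewrite /cpoly coef_rVpoly; case: insubP => [i' ir <-|/negPf -> //].
by rewrite ltn_ord !mxE; apply: eq_bigr => j _; rewrite MF.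
Qed.

Lemma cpoly_Xmx r s (c : 'cV_s) : (s <= r)%N -> cpoly (Xmx k r s *m c) = cpoly c.
Proof.
move=> sr; apply/polyP => i.
rewrite (cpoly_mulmx (F := fun i j => (i == j)%:R)); last by move=> *; rewrite mxE.
case: ltnP => ri; first by rewrite coef_cpoly.
by rewrite nth_default // (leq_trans (size_cpoly c)) // (leq_trans sr).
Qed.

Lemma cpoly_Ymx s (c : 'cV_s) : cpoly (Ymx k s.+1 s *m c) = cpoly c * 'X.
Proof.
apply/polyP => i.
rewrite (cpoly_mulmx (F := fun i j => (i == j.+1)%:R)); last first.
  by move=> *; rewrite mxE subSnn addn1.
rewrite coefMX; case: i => [|i] /=; first by rewrite big1 // => j _; rewrite mul0r.
rewrite ltnS; case: ltnP => si; first by rewrite coef_cpoly.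
by rewrite nth_default // (leq_trans (size_cpoly c)).
Qed.

(** Z(l) is multiplication by 1 + l 'X; the truncation has no effect for r > s, but a square Z has
    no row for the new top coefficient. *)
Lemma cpoly_Zmx r s l (c : 'cV_s) :
  cpoly (Zmx r s l *m c) = take_poly r (cpoly c + l *: (cpoly c * 'X)).
Proof.
apply/polyP => i.
rewrite (cpoly_mulmx (F := fun i j => (i == j)%:R + l * (i == j.+1)%:R));
  last first.
  by move=> *; rewrite mxE.
rewrite coef_take_poly; case: ifP => // _; rewrite coefD coefZ coefMX coef_cpoly.
under eq_bigr => j _ do rewrite mulrDl -mulrA.
rewrite big_split -mulr_sumr /=; congr (_ + _ * _).
case: i => [|i] /=; first by rewrite big1 // => j _; rewrite mul0r.
by rewrite coef_cpoly.
Qed.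

Lemma Zmx_unit d l : Zmx d d l \in @unitmx k d.
Proof.
rewrite unitmxE det_trig.
  rewrite big1 ?unitr1 // => i _; rewrite mxE eqxx.
  by rewrite (ltn_eqF (ltnSn i)) mulr0 addr0.
apply/is_trig_mxP => i j ij; rewrite mxE.
by rewrite (ltn_eqF ij) (ltn_eqF (ltn_trans ij (ltnSn j))) mulr0 addr0.
Qed.

End ColumnPolynomials.

(** * Images of the composite arm matrices in the vertex 0 *)

Section ArmMatrices.
Variables (k : fieldType) (W : weights k).
Local Notation t := (nb W).
Local Notation p := (@wt k W).
Variables (i1 i2 i3 : 'I_t) (n : nat).
Hypotheses (lt12 : (i1 < i2)%N) (lt23 : (i2 < i3)%N).

(** The match recovers the block sizes: [ldim n l] reduces to a sum only once the level is known. *)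
Definition up l (c : 'cV[k]_(ldim n l)) : {poly k} :=
  match l return 'cV[k]_(ldim n l) -> _ with
  | L3 => fun c : 'cV_(n.+1 + n.+2) => cpoly (usubmx c)
  | L2 => fun c : 'cV_(n.+1 + n.+1) => cpoly (usubmx c)
  | L1 => fun c : 'cV_(n + n.+1) => cpoly (usubmx c)
  end c.
Definition dn l (c : 'cV[k]_(ldim n l)) : {poly k} :=
  match l return 'cV[k]_(ldim n l) -> _ with
  | L3 => fun c : 'cV_(n.+1 + n.+2) => cpoly (dsubmx c)
  | L2 => fun c : 'cV_(n.+1 + n.+1) => cpoly (dsubmx c)
  | L1 => fun c : 'cV_(n + n.+1) => cpoly (dsubmx c)
  end c.

Arguments up : simpl never.
Arguments dn : simpl never.

Lemma updn_inj l (c c' : 'cV[k]_(ldim n l)) : up c = up c' -> dn c = dn c' -> c =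
  c'.
Proof.
by case: l c c' => c c' /cpoly_inj e /cpoly_inj e';
  rewrite -[c]vsubmxK -[c']vsubmxK e e'.
Qed.

Definition updims (l : level) : nat * nat :=
  match l with L3 => (n.+1, n.+2) | L2 => (n.+1, n.+1) | L1 => (n, n.+1) end.

Lemma updn_surj l (u v : {poly k}) : (size u <= (updims l).1)%N ->
  (size v <= (updims l).2)%N -> exists c : 'cV[k]_(ldim n l), up c = u /\ dn c = v.
Proof.
by case: l => /cpoly_surj[c <-] /cpoly_surj[c' <-]; exists (col_mx c c');
  rewrite /up /dn ?col_mxKu ?col_mxKd.
Qed.

Lemma size_up l (c : 'cV[k]_(ldim n l)) : (size (up c) <= (updims l).1)%N.
Proof. by case: l c => c; apply: size_cpoly. Qed.
Lemma size_dn l (c : 'cV[k]_(ldim n l)) : (size (dn c) <= (updims l).2)%N.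
Proof. by case: l c => c; apply: size_cpoly. Qed.

(* Multiplication by [ell i] is [xy i] followed by [twist i]; the matrices carry
   the factor [twist i] on the first arrow of the arm. *)
Definition xy (i : 'I_t) (q : {poly k}) := if i == arm2 W then q * 'X else q.

Lemma cpoly_XYmx (i : 'I_t) s (c : 'cV_s) : cpoly (XYmx i s.+1 s *m c) =
  xy i (cpoly c).
Proof. by rewrite /XYmx /xy; case: ifP => _; rewrite ?cpoly_Ymx ?cpoly_Xmx. Qed.

Definition twist (i : 'I_t) d (q : {poly k}) :=
  if (2 <= i)%N then take_poly d (ell i * q) else q.

Lemma up_first i (c : 'cV_(ldim n L3)) : up (first_mx n i L3 *m c) =
  twist i n.+1 (up c).
Proof.
rewrite /first_mx /twist /up; case: leqP => i2'; first by rewrite mul1mx.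
rewrite -[in LHS](vsubmxK (c :
  'cV_(n.+1 + n.+2))) mul_block_col !mul0mx addr0 col_mxKu.
by rewrite cpoly_Zmx ell_ge2 // mulrDl mul1r -scalerAl ['X * _]mulrC.
Qed.

Lemma dn_first i (c : 'cV_(ldim n L3)) : dn (first_mx n i L3 *m c) =
  twist i n.+2 (dn c).
Proof.
rewrite /first_mx /twist /dn; case: leqP => i2'; first by rewrite mul1mx.
rewrite -[in LHS](vsubmxK (c :
  'cV_(n.+1 + n.+2))) mul_block_col !mul0mx add0r col_mxKd.
by rewrite cpoly_Zmx ell_ge2 // mulrDl mul1r -scalerAl ['X * _]mulrC.
Qed.

Lemma twist_xy i d (q : {poly k}) : (size q < d)%N -> twist i d (xy i q) =
  ell i * q.
Proof.
move=> sq; rewrite /twist /xy; case: leqP => i2'; last first.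
  rewrite -val_eqE /= gtn_eqF // take_poly_id // mulrC.
  by case: d sq => // d; apply: size_mul_ell.
have [->|i2n] := eqVneq i (arm2 W); first by rewrite ell_arm2 mulrC.
suff -> : i = arm1 W by rewrite ell_arm1 mul1r.
by apply: val_inj; move: i2' i2n; rewrite -val_eqE /=; case: (val i) => [|[|?]].
Qed.

Lemma up_step32 i (c : 'cV_(ldim n L2)) :
  up (step_mx i1 i3 n i L3 L2 *m c) = if i == i1 then - up c else up c.
Proof.
rewrite /step_mx /up -[in LHS](vsubmxK (c : 'cV_(n.+1 + n.+1))); case: ifP => _;
  rewrite mul_block_col !mul0mx addr0 col_mxKu ?mulNmx mul1mx //.
by rewrite linearN.
Qed.

Lemma dn_step32 i (c : 'cV_(ldim n L2)) :
  dn (step_mx i1 i3 n i L3 L2 *m c) =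
  if i == i1 then up c - lam i3 *: (up c * 'X) + xy i (dn c) else xy i (dn c).
Proof.
rewrite /step_mx /up /dn -[in LHS](vsubmxK (c : 'cV_(n.+1 + n.+1))); case: ifP => _;
  rewrite mul_block_col ?mul0mx ?add0r col_mxKd ?raddfD /= cpoly_XYmx //.
rewrite cpoly_Zmx take_poly_id ?scaleNr //.
rewrite (leq_trans (size_polyD _ _)) // geq_max (leq_trans (size_cpoly _)) //=
  size_polyN.
rewrite (leq_trans (size_scale_leq _ _)) // (leq_trans (size_polyMleq _ _)) //.
by rewrite size_polyX addn2 /= ltnS size_cpoly.
Qed.

Lemma up_step31 i (c : 'cV_(ldim n L1)) :
  up (step_mx i1 i3 n i L3 L1 *m c) = xy i (up c).
Proof.
rewrite /step_mx /up -[in LHS](vsubmxK (c : 'cV_(n + n.+1))).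
by rewrite mul_block_col !mul0mx addr0 col_mxKu cpoly_XYmx.
Qed.

Lemma dn_step31 i (c : 'cV_(ldim n L1)) :
  dn (step_mx i1 i3 n i L3 L1 *m c) = xy i (dn c).
Proof.
rewrite /step_mx /dn -[in LHS](vsubmxK (c : 'cV_(n + n.+1))).
by rewrite mul_block_col !mul0mx add0r col_mxKd cpoly_XYmx.
Qed.

Lemma up_step21 i (c : 'cV_(ldim n L1)) :
  up (step_mx i1 i3 n i L2 L1 *m c) = if i ==
    i1 then - xy i (up c) else xy i (up c).
Proof.
rewrite /step_mx /up -[in LHS](vsubmxK (c : 'cV_(n + n.+1))); case: ifP => _;
  rewrite mul_block_col !mul0mx addr0 col_mxKu ?mulNmx ?raddfN /= cpoly_XYmx //.
Qed.

Lemma dn_step21 i (c : 'cV_(ldim n L1)) :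
  dn (step_mx i1 i3 n i L2 L1 *m c) =
  if i == i1 then up c - lam i3 *: (up c * 'X) + dn c else dn c.
Proof.
rewrite /step_mx /up /dn -[in LHS](vsubmxK (c : 'cV_(n + n.+1))); case: ifP => _;
  rewrite mul_block_col ?mul0mx ?add0r col_mxKd ?raddfD /= mul1mx //.
rewrite cpoly_Zmx take_poly_id ?scaleNr //.
rewrite (leq_trans (size_polyD _ _)) // geq_max (leq_trans (size_cpoly _)) //=
  size_polyN.
rewrite (leq_trans (size_scale_leq _ _)) // (leq_trans (size_polyMleq _ _)) //.
by rewrite size_polyX addn2 /= ltnS size_cpoly.
Qed.

Lemma xy_linear i : linear (xy i).
Proof. by move=> a u v; rewrite /xy; case: ifP => _; rewrite ?mulrDl ?scalerAl. Qed.
HB.instance Definition _ i := GRing.isLinear.Build k {poly k} {poly k} *:%R (xy i)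
  (xy_linear i).

(** On the arm i1 the off-diagonal terms cancel: multiplication by 1 - lam_i3 'X commutes with
    [xy i], and the minus signs of the diagonal blocks give the two terms opposite signs. *)
Lemma step_mxM i : step_mx i1 i3 n i L3 L2 *m step_mx i1 i3 n i L2 L1 =
  step_mx i1 i3 n i L3 L1.
Proof.
suff h (c : 'cV_(ldim n L1)) :
  step_mx i1 i3 n i L3 L2 *m (step_mx i1 i3 n i L2 L1 *m c) =
  step_mx i1 i3 n i L3 L1 *m c.
  apply/matrixP => a' b'; have := h (delta_mx b' 0).
  by rewrite mulmxA -!colE => /matrixP/(_ a' 0); rewrite !mxE.
apply: updn_inj.
  rewrite up_step32 up_step31 up_step21; by case: (i == i1); rewrite ?opprK.
rewrite dn_step32 dn_step31 up_step21 dn_step21; case: (i == i1) => //.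
rewrite [X in _ + X](_ : _ = xy i (up c) - lam i3 *:
  (xy i (up c) * 'X) + xy i (dn c)).
  by rewrite -!mul_polyC; ring.
by rewrite /xy; case: ifP => // _; rewrite -!mul_polyC; ring.
Qed.

Lemma first_unit (i : 'I_t) : first_mx n i L3 \in @unitmx k (n.+1 + n.+2).
Proof.
rewrite /first_mx; case: leqP => i2'; first exact: unitmx1.
have := Zmx_unit n.+1 (lam i); have := Zmx_unit n.+2 (lam i).
by rewrite !unitmxE det_ublock unitrM => -> ->.
Qed.

(* The composite of the first m arrows of the i-th arm, if its m-th vertex has
   level l. *)
Definition armmx (i : 'I_t) (m : nat) (l : level) : 'M[k]_(ldim n L3, ldim n l) :=
  (if m == 0%N then 1%:M else first_mx n i L3) *m step_mx i1 i3 n i L3 l.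

Lemma armmxSE i m l :
  armmx i m.+1 l = first_mx n i L3 *m step_mx i1 i3 n i L3 l.
Proof. by []. Qed.

Definition descends (l l' : level) : bool :=
  match l, l' with L3, _ | L2, L2 | L2, L1 | L1, L1 => true | _, _ => false end.

Lemma armmxS i m l l' : (m = 0%N -> l = L3) -> descends l l' ->
  armmx i m l *m (if m == 0%N then first_mx n i l *m step_mx i1 i3 n i l l'
                  else step_mx i1 i3 n i l l') = armmx i m.+1 l'.
Proof.
rewrite /armmx; case: eqP => [m0 /(_ m0) -> _|_ _] /=.
  by rewrite mul1mx mul1mx.
rewrite -mulmxA => h; congr (_ *m _).
case: l l' h => -[] //= _; rewrite ?mulmx1 ?mul1mx //; exact: step_mxM.
Qed.

Lemma xy_eq0 i q : xy i q = 0 -> q = 0.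
Proof.
by rewrite /xy; case: ifP => // _ /eqP; rewrite mulf_eq0 polyX_eq0 orbF => /eqP.
Qed.

Lemma up0 l : up (0 : 'cV[k]_(ldim n l)) = 0.
Proof. by case: l; rewrite /up !linear0. Qed.
Lemma dn0 l : dn (0 : 'cV[k]_(ldim n l)) = 0.
Proof. by case: l; rewrite /dn !linear0. Qed.

Lemma updn_eq0 l (c : 'cV[k]_(ldim n l)) : up c = 0 -> dn c = 0 -> c = 0.
Proof. by move=> u d; apply: updn_inj; rewrite ?u ?d ?up0 ?dn0. Qed.

Lemma step_mx_eq0 i l (c : 'cV_(ldim n l)) : step_mx i1 i3 n i L3 l *m c = 0 ->
  c = 0.
Proof.
move=> h; have := up0 L3; have := dn0 L3; rewrite -h; case: l c {h} => c.
- by rewrite /step_mx mul1mx => d u; apply: updn_eq0.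
- rewrite up_step32 dn_step32; case: ifP => _ d u; last first.
    by apply: updn_eq0 => //; apply: xy_eq0 d.
  have u0 : up c = 0 by apply: oppr_inj; rewrite u oppr0.
  apply: updn_eq0 => //; apply: (@xy_eq0 i).
  by move: d; rewrite u0 mul0r scaler0 subr0 add0r.
by rewrite up_step31 dn_step31 => d u; apply: updn_eq0; [exact: xy_eq0 u|exact:
  xy_eq0 d].
Qed.

Lemma armmx_eq0 i m l (c : 'cV_(ldim n l)) : armmx i m l *m c = 0 -> c = 0.
Proof.
rewrite /armmx -mulmxA; case: ifP => _; first by rewrite mul1mx => /step_mx_eq0.
move=> /(congr1 (mulmx (invmx (first_mx n i L3)))).
by rewrite mulKmx ?first_unit // mulmx0 => /step_mx_eq0.
Qed.

Lemma armmx_surj3 i m (U V : {poly k}) : (size U <= n.+1)%N -> (size V <= n.+2)%N ->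
  exists c : 'cV_(ldim n L3), up (armmx i m L3 *m c) = U /\
    dn (armmx i m L3 *m c) = V.
Proof.
move=> sU sV; have [c [<- <-]] := @updn_surj L3 U V sU sV; rewrite /armmx.
case: ifP => _; first by exists c; rewrite /step_mx !mul1mx.
exists (invmx (first_mx n i L3) *m c).
by rewrite /step_mx mulmx1 mulKVmx ?first_unit.
Qed.

Lemma armmx1E i m (c : 'cV_(ldim n L1)) : (0 < m)%N ->
  up (armmx i m L1 *m c) = ell i * up c /\ dn (armmx i m L1 *m c) = ell i * dn c.
Proof.
case: m => // m _; rewrite armmxSE -mulmxA up_first dn_first up_step31 dn_step31.
by rewrite !twist_xy // ltnS; [exact: (size_dn c)|exact: (size_up c)].
Qed.

Lemma twist_surj i d (U : {poly k}) : (size U <= d)%N ->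
  exists2 q : {poly k}, (size q <= d)%N & twist i d q = U.
Proof.
move=> sU; rewrite /twist; case: leqP => i2'; first by exists U.
have [u <-] := cpoly_surj sU; exists (cpoly (invmx (Zmx d d (lam i)) *m u)).
  exact: size_cpoly.
rewrite -[in RHS](mulKVmx (Zmx_unit d (lam i)) u) cpoly_Zmx.
by rewrite ell_ge2 // mulrDl mul1r -scalerAl ['X * _]mulrC.
Qed.

Lemma twist_linear i d : linear (twist i d).
Proof.
move=> a u v; rewrite /twist; case: ifP => _ //.
by rewrite mulrDr -scalerAr take_polyD take_polyZ.
Qed.
HB.instance Definition _ i d :=
  GRing.isLinear.Build k {poly k} {poly k} *:%R (twist i d)
  (twist_linear i d).

Lemma take_poly_ell (i : 'I_t) d (q : {poly k}) : (2 <= i)%N -> (size q <=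
  d.+1)%N ->
  take_poly d.+1 (ell i * q) = ell i * q - (lam i * q`_d) *: 'X^(d.+1).
Proof.
move=> i2' sq; apply/polyP => j;
  rewrite coef_take_poly coefB coefZ coefXn ell_ge2 //.
rewrite mulrDl mul1r -scalerAl coefD coefZ coefXM.
case: (ltngtP j d.+1) => [_|dj|->] /=; first by rewrite mulr0 subr0.
  have -> : q`_j = 0 by rewrite nth_default // (leq_trans sq) // ltnW.
  have -> : q`_j.-1 = 0 by rewrite nth_default // (leq_trans sq); case: j dj.
  by rewrite mulr0 if_same mulr0 addr0 subr0.
by rewrite (nth_default _ sq) add0r mulr1 subrr.
Qed.

(* Over the arm i1, the matrices have 1 - lam_i3 X where the cokernel has
   [- ell i3].  What matters is their class modulo [ell i1] (after the twist), and
   the two classes differ by this factor. *)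
Definition rescale : k :=
  if i1 == arm1 W then 1 else if i1 ==
    arm2 W then -1 else lam i3 / (lam i3 - lam i1).

Lemma i3_ge2 : (2 <= i3)%N.
Proof. by apply: leq_ltn_trans lt23; case: (val i2) lt12. Qed.

Lemma lam13 : (2 <= i1)%N -> lam i3 - lam i1 != 0.
Proof.
move=> h; rewrite subr_eq0; apply/negP => /eqP /(lam_inj i3_ge2 h) e.
by have := ltn_trans lt12 lt23; rewrite e ltnn.
Qed.

Lemma i1_ge2 : i1 != arm1 W -> i1 != arm2 W -> (2 <= i1)%N.
Proof. by rewrite -!val_eqE /=; case: (val i1) => [|[|?]]. Qed.

Lemma rescale_neq0 : rescale != 0.
Proof.
rewrite /rescale; case: (eqVneq i1 (arm1 W)) => [_|h1]; first exact: oner_neq0.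
case: (eqVneq i1 (arm2 W)) => [_|h2]; first by rewrite oppr_eq0 oner_neq0.
by rewrite mulf_neq0 ?invr_eq0 ?lam13 ?i1_ge2 // lam_neq0 // i3_ge2.
Qed.

(** For i1 beyond the second arm, both twists are multiples of [ell i1] up to the coefficient that
    was cut off, which is a multiple of the top coefficient of q; comparing these defects at the
    root -1/lam_i1 gives lam_i3 / (lam_i3 - lam_i1). *)
Lemma rescale_key (q : {poly k}) : (size q <= n.+1)%N ->
  exists2 G : {poly k}, (size G <= n.+1)%N &
    twist i1 n.+2 (q - lam i3 *: (q * 'X)) + rescale *: ell i3 * twist i1 n.+1 q =
      ell i1 * G.
Proof.
move=> sq; have e3 := ell_ge2 i3_ge2; rewrite /rescale.
case: (eqVneq i1 (arm1 W)) => [h1|h1].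
  (* Here [ell i1] is 1 and the content is the size of G: the terms lam_i3 'X q cancel. *)
  exists (q + q); first by rewrite (leq_trans (size_polyD _ _)) // geq_max sq.
  by rewrite /twist h1 ell_arm1 e3 /= -!mul_polyC; ring.
case: (eqVneq i1 (arm2 W)) => [h2|h2].
  exists (- (lam i3 *: (q + q))).
    rewrite size_polyN (leq_trans (size_scale_leq _ _)) //.
    by rewrite (leq_trans (size_polyD _ _)) // geq_max sq.
  by rewrite /twist h2 ell_arm2 e3 /= -!mul_polyC; ring.
have i1g := i1_ge2 h1 h2; have l13 := lam13 i1g.
set r := lam i3 / _; have er : r * (lam i3 - lam i1) = lam i3 by rewrite divfK.
have sqX : (size (q * 'X)%R <= n.+2)%N.
  by rewrite (leq_trans (size_polyMleq _ _)) // size_polyX addn2.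
have qn : (q - lam i3 *: (q * 'X))`_n.+1 = - (lam i3 * q`_n).
  by rewrite coefB coefZ coefMX /= nth_default // sub0r.
(* The last term comes from truncating the twist of q. The choice of r kills the coefficient of
   'X^(n+1) and so gives the size bound. *)
exists (q - lam i3 *: (q * 'X) + r *: (ell i3 * q) - (r * lam i1 * q`_n) *:
  'X^(n.+1)).
  apply/leq_sizeP => j; rewrite leq_eqVlt => /orP[/eqP <-|nj].
    rewrite coefB coefD qn !coefZ coefXn eqxx mulr1 e3 mulrDl mul1r -scalerAl.
    rewrite coefD coefZ coefXM /= (nth_default _ sq) add0r.
    transitivity (q`_n * (r * (lam i3 - lam i1) - lam i3)); first by ring.
    by rewrite er subrr mulr0.
  rewrite coefB coefD coefB !coefZ coefXn e3 mulrDl mul1r -scalerAl coefD coefZ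
    coefXM coefMX.
  have -> : q`_j = 0 by rewrite nth_default // (leq_trans sq) // ltnW.
  have -> : q`_j.-1 = 0 by rewrite nth_default // (leq_trans sq); case: j nj.
  by rewrite (gtn_eqF nj) !if_same mulr0n; ring.
rewrite /twist i1g !take_poly_ell //; last first.
  rewrite (leq_trans (size_polyD _ _)) // geq_max (leq_trans sq) //= size_polyN.
  exact: leq_trans (size_scale_leq _ _) sqX.
rewrite qn e3 ell_ge2 // exprS; set Q := q`_n; move: ('X ^+ n.+1 : {poly k}) => Y.
set R := RHS; transitivity (R + (lam i1 * Q * (lam i3 - r * (lam i3 - lam i1))) *:
  ('X * Y)).
  by rewrite /R -!mul_polyC !(polyCM, polyCB, polyCN); ring.
by rewrite er subrr mulr0 scale0r addr0.
Qed.

(** At level L2 the image of the arm i consists of the pairs (U, V), of bounded size, with V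
    congruent to [kappa i] U modulo [ell i]. *)
Definition kappa (i : 'I_t) : {poly k} := if i == i1 then rescale *: ell i3 else 0.

Lemma armmx2E i m (c : 'cV_(ldim n L2)) : (0 < m)%N ->
  exists2 G : {poly k}, (size G <= n.+1)%N &
    dn (armmx i m L2 *m c) = kappa i * up (armmx i m L2 *m c) + ell i * G.
Proof.
case: m => // m _; rewrite armmxSE -mulmxA up_first dn_first up_step32 dn_step32
  /kappa.
have sd := size_dn c; case: eqP => [->|_]; last first.
  by exists (dn c) => //; rewrite mul0r add0r twist_xy.
have [G sG eG] := rescale_key (size_up c).
exists (G + dn c); first by rewrite (leq_trans (size_polyD _ _)) // geq_max sG.
rewrite linearD linearN /= twist_xy // mulrDr -eG; ring.
Qed.

Lemma armmx_surj2 i m (U G : {poly k}) : (0 < m)%N ->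
  (size U <= n.+1)%N -> (size G <= n.+1)%N ->
  exists c : 'cV_(ldim n L2), up (armmx i m L2 *m c) = U /\
    dn (armmx i m L2 *m c) = kappa i * U + ell i * G.
Proof.
case: m => // m _ sU sG; rewrite armmxSE /kappa; case: (eqVneq i i1) => [->|ne];
  last first.
  have [q sq eq] := twist_surj i sU; have [c [cu cd]] := @updn_surj L2 q G sq sG.
  exists c; rewrite -mulmxA up_first dn_first up_step32 dn_step32 (negPf ne) cu cd
    eq.
  by rewrite twist_xy // mul0r add0r.
(* The sign undoes the negated upper block of the i1-matrix. *)
have [|q sq eq] := @twist_surj i1 n.+1 (- U); first by rewrite size_polyN.
have [G' sG' eG'] := rescale_key sq.
have [|c [cu cd]] := @updn_surj L2 q (G - G') sq.
  by rewrite (leq_trans (size_polyD _ _)) // geq_max sG size_polyN.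
exists c; rewrite -mulmxA up_first dn_first up_step32 dn_step32 eqxx cu cd.
rewrite linearN /= eq opprK linearD /= twist_xy; last first.
  by rewrite -cd; exact: (size_dn c).
split=> //; rewrite mulrBr -eG' eq; ring.
Qed.

Lemma armmx_surj1 i m (U V : {poly k}) : (0 < m)%N -> (size U <= n)%N ->
  (size V <= n.+1)%N ->
  exists c : 'cV_(ldim n L1), up (armmx i m L1 *m c) = ell i * U /\
    dn (armmx i m L1 *m c) = ell i * V.
Proof.
move=> m0 sU sV; have [c [<- <-]] := @updn_surj L1 U V sU sV.
by exists c; apply: armmx1E.
Qed.

End ArmMatrices.

Arguments up : simpl never.
Arguments dn : simpl never.

(** A relation is convenient because a section determines its tuple only up to boundaries, and
    tuples and columns are compared only through their images at the vertex 0. *)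
Lemma linear_bij_of_rel (k : fieldType) (U V : lmodType k) (R : U -> V -> Prop) :
  (forall c u v u' v', R u v -> R u' v' -> R (c *: u + u') (c *: v + v')) ->
  (forall u, exists v, R u v) -> (forall v, exists u, R u v) ->
  (forall v, R 0 v -> v = 0) -> (forall u, R u 0 -> u = 0) ->
  exists phi : {linear U -> V}, bijective phi /\ forall u v, R u v -> phi u = v.
Proof.
move=> Rlin Rtot Ronto Rfun Rinj.
have Rsub u v u' v' : R u v -> R u' v' -> R (u - u') (v - v').
  by move=> h h'; rewrite -[u - _]addrC -[v - _]addrC -!scaleN1r; apply: Rlin.
have [f fR] := choice Rtot; have [f' f'R] := choice Ronto.
have fE u v : R u v -> f u = v.
  move=> h; apply/eqP; rewrite -subr_eq0; apply/eqP/Rfun; rewrite -(subrr u).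
  exact: Rsub.
have flin : linear f by move=> c u v; apply: fE; apply: Rlin.
pose phi := HB.pack f (GRing.isLinear.Build k U V *:%R f flin) : {linear U -> V}.
exists phi; split; last exact: fE.
exists f' => [u|v]; last exact: (fE _ _ (f'R v)).
apply/eqP; rewrite -subr_eq0; apply/eqP/Rinj; rewrite -(subrr (f u)).
by apply: Rsub; [exact: (f'R (f u))|exact: fR].
Qed.

(** * Comparison of the two representations *)

Section Represents.
Variables (k : fieldType) (W : weights k).
Local Notation t := (nb W).
Local Notation p := (@wt k W).
Local Notation LL := (LL W).
Local Notation SS := (SS W).
Local Notation xS := (@xS k W).
Local Notation Sdeg := (@Sdeg k W).
Variables (I : {set 'I_t}) (b : 'I_t -> nat) (y : LL).
Local Notation J := {l : 'I_t | l \in I}.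

(** Tuples are indexed by all arms, with arbitrary values off I, so that components can be named
    without membership proofs. *)
Definition represents (z : LL) (g : germs I b) (w : 'I_t -> SS) : Prop :=
  (forall q, q \in I -> Sdeg (y + z + xv q *+ b q) (w q)) /\
  forall P, g P = stalk_frac b (fun q : J => w (val q)) (denom1 P).

Lemma represents_lin z c g w g' w' : represents z g w -> represents z g' w' ->
  represents z (c *: g + g') (fun q => @kS k W c * w q + w' q).
Proof.
move=> [dw gw] [dw' gw']; split=> [q qI|P].
  by apply: SdegD; [apply/SdegZ/dw|apply: dw'].
rewrite -[LHS]/(tolocS P (@kS k W c) *: g P + g' P) gw gw' stalk_fracZ.
have h11 : (1 : SS) * 1 \in denom P by rewrite mulr1; apply: denom1.
rewrite (stalk_fracD _ _ _ (denom1 P) (denom1 P) h11).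
rewrite /stalk_frac; congr tocoker; apply/ffunP => q; rewrite !ffunE.
by apply: frac_eq; rewrite !mulr1.
Qed.

Lemma represents_mulx z i g w : represents z g w ->
  represents (z + xv i) (germs_mul (xS i) g) (fun q => xS i * w q).
Proof.
move=> [dw gw]; split=> [q qI|P].
  rewrite (_ : y + _ + _ = xv i + (y + z + xv q *+ b q)).
    by apply: SdegM; [apply: Sdegx|apply: dw].
  by rewrite [RHS]addrC (addrA y z) (addrAC (y + z)).
by rewrite -[LHS]/(tolocS P (xS i) *: g P) gw stalk_fracZ.
Qed.

Lemma represents_section z w :
  (forall q, q \in I -> Sdeg (y + z + xv q *+ b q) (w q)) ->
  exists2 g, g \in is_section y z & represents z g w.
Proof.
move=> dw; exists (fun P => stalk_frac b (fun q : J => w (val q)) (denom1 P)) => //.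
apply/asboolP => P; exists 1, 1, (fun q : J => w (val q)), 0.
split; [exact: denom1|exact: Sdeg1| |by move=> Q h; exists (denom1 Q)].
by move=> q; rewrite addr0 addrAC; apply: dw; apply: (valP q).
Qed.

Variables (i j : 'I_t) (iI : i \in I) (jI : j \in I) (i1 : i != arm1 W)
  (ij : i != j) (bi : (b i < p i)%N).

Lemma represents_exists z r l (g : germs I b) : normal_form (y + z) r l -> -1 <=
  l ->
  g \in is_section y z -> exists w, represents z g w.
Proof.
move=> nfz l1 sg.
have [a da ga] := @section_global _ _ _ _ (Sub i iI) (Sub j jI) i1 ij bi _ _ _ _ _
  nfz l1 sg.
exists (fun q => if (insub q : option J) is Some q' then a q' else 0).
split=> [q qI|P].
  by case: insubP => [q' _ <-|]; [exact: da|rewrite qI].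
rewrite ga; congr (stalk_frac b (P := P) _ (denom1 P)); apply/funext => q.
by rewrite valK.
Qed.

Lemma represents_eq0 z g w : represents z g w ->
  g = 0 <-> exists2 d, Sdeg (y + z) d & forall q, q \in I -> w q = xS q ^+ b q * d.
Proof.
move=> [dw gw]; have h P : g P = 0 <-> bdry b (y + z) (fun q : J => w (val q)).
  rewrite gw; apply: (@stalk_frac_eq0 _ _ _ _ (Sub i iI) (Sub j jI)) => // q.
  exact/dw/(valP q).
have e : bdry b (y + z) (fun q : J => w (val q)) <->
    exists2 d, Sdeg (y + z) d & forall q, q \in I -> w q = xS q ^+ b q * d.
  split=> [[d dd wd]|[d dd wd]]; exists d => // q; last exact/wd/(valP q).
  by move=> qI; apply: (wd (Sub q qI)).
split=> [g0|/e hb]; first by apply/e/(h (generic_point W)); rewrite g0.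
by apply: functional_extensionality_dep => P; apply/h.
Qed.

Lemma represents_torsion z v h c w g : represents z g w -> Sdeg v h -> h != 0 ->
  (forall q, q \in I -> h * w q = xS q ^+ b q * c) -> g = 0.
Proof.
move=> gw dh h0 hc; apply/(represents_eq0 gw); have [dw _] := gw.
have [||d dd wd] := @coker_torsion_free _ _ I b (y + z) v h c (Sub i iI) (Sub j jI)
  (fun q => w (val q)) i1 ij bi _ dh h0.
- by move=> q; apply/dw/(valP q).
- by move=> q; apply/hc/(valP q).
by exists d => // q qI; apply: (wd (Sub q qI)).
Qed.

End Represents.

Section PolynomialPictures.
Variables (k : fieldType) (W : weights k).
Local Notation t := (nb W).
Local Notation p := (@wt k W).
Local Notation LL := (LL W).
Local Notation SS := (SS W).
Local Notation xS := (@xS k W).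
Local Notation Sdeg := (@Sdeg k W).

(** Converse of [Sdeg_divx]; together they describe the multiples of x_i^m in S_z by their
    polynomials. *)
Lemma dehom_divx z r l i m s : normal_form z r l -> (m <= p i)%N ->
  Sdeg (z - xv i *+ m) s ->
  (m <= r i)%N \/ exists2 G : {poly k}, (size G <= psize (l - 1))%N &
    dehom z (xS i ^+ m * s) = ell i * G.
Proof.
move=> nfz mp ds; case: (leqP m (r i)) => mr; first by left.
have normal_form' := nf_subx_carry (i := i) (m := m) nfz;
  rewrite mr mp in normal_form'.
right; exists (dehom (z - xv i *+ m) s); first exact:
  dehom_size (normal_form' isT) ds.
have := dehom_mulx i m (normal_form' isT) ds; rewrite eqxx subrK => ->.
rewrite -addnA subnK // divnDr ?dvdnn // divnn wt_gt0 divn_small ?addn1 ?expr1 //.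
exact: nfz.1.
Qed.

End PolynomialPictures.

Lemma psize_pred d : psize (d%:Z - 1) = d.
Proof. by case: d => //= d; rewrite subn1. Qed.

(** * The cokernel of type B_3 and its isomorphism with the matrices *)

Section B3.
Variables (k : fieldType) (W : weights k).
Local Notation t := (nb W).
Local Notation p := (@wt k W).
Local Notation LL := (LL W).
Local Notation SS := (SS W).
Local Notation xS := (@xS k W).
Local Notation Sdeg := (@Sdeg k W).
Variables (i1 i2 i3 : 'I_t) (n : nat) (a b : 'I_t -> nat).
Hypotheses (lt12 : (i1 < i2)%N) (lt23 : (i2 < i3)%N)
  (a_lt : forall i, (a i <= p i - 1)%N)
  (b_bound : forall i, i \in [set i1; i2; i3] -> (1 <= b i <= p i - 1)%N)
  (carry3 : (p i3 <= a i3 + b i3)%N)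
  (nocarry1 : (a i1 + b i1 < p i1)%N)
  (nocarry2 : (a i2 + b i2 < p i2)%N).
Local Notation I := [set i1; i2; i3].
Local Notation lev := (arm_level i1 i2 i3 a b).
Local Notation amx := (armmx i1 i3 n).
Local Notation rr := (rescale i1 i3).
Let y : LL := cv W *+ n + \sum_i xv i *+ a i.

Let ne12 : i1 != i2. Proof. by rewrite -val_eqE ltn_eqF. Qed.
Let ne23 : i2 != i3. Proof. by rewrite -val_eqE ltn_eqF. Qed.
Let ne13 : i1 != i3. Proof. by rewrite -val_eqE ltn_eqF // (ltn_trans lt12). Qed.
Let i2arm1 : i2 != arm1 W.
Proof. by rewrite -val_eqE /= -lt0n; apply: leq_ltn_trans lt12. Qed.
Let i1I : i1 \in I. Proof. by rewrite !inE eqxx. Qed.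
Let i2I : i2 \in I. Proof. by rewrite !inE eqxx orbT. Qed.
Let i3I : i3 \in I. Proof. by rewrite !inE eqxx orbT. Qed.
Let b2p : (b i2 < p i2)%N.
Proof. by have := b_bound i2I; have := wt_ge2 i2; lia. Qed.
Let ap i : (a i < p i)%N. Proof. by have := a_lt i; have := wt_ge2 i; lia. Qed.
Let b3p : (b i3 < p i3)%N.
Proof. by have := b_bound i3I; have := wt_ge2 i3; lia. Qed.

Let c3_le : (a i3 + b i3 - p i3 <= a i3)%N.
Proof. by rewrite leq_subLR addnC leq_add2r ltnW. Qed.
Let c3_lt : (a i3 + b i3 - p i3 < p i3)%N.
Proof. exact: leq_ltn_trans c3_le (ap i3). Qed.

Lemma I_ind (P : 'I_t -> Prop) : P i1 -> P i2 -> P i3 -> forall q, q \in I -> P q.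
Proof. by move=> h1 h2 h3 q; rewrite !inE => /orP[/orP[]|] /eqP ->. Qed.

Lemma nf_y : normal_form y a n%:Z.
Proof. by split=> //; rewrite /y addrC. Qed.

(* The residues modulo the p_i of y + b_q x_q, and its coefficient of c. *)
Definition res (q : 'I_t) (i : 'I_t) : nat :=
  if i == q then if q == i3 then (a q + b q - p q)%N else (a q + b q)%N else a i.
Definition cnum (q : 'I_t) : nat := if q == i3 then n.+1 else n.

Lemma nf_yb q : q \in I -> normal_form (y + xv q *+ b q) (res q) (cnum q)%:Z.
Proof.
move=> qI; have := nf_addx q (b q) nf_y.
have e2 : ((a q + b q) %/ p q = (q == i3))%N.
  move: q qI; apply: I_ind; rewrite ?(negPf ne13) ?(negPf ne23) ?eqxx.
  - by rewrite divn_small.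
  - by rewrite divn_small.
  by rewrite -{1}(subnK carry3) divnDr ?dvdnn // divnn wt_gt0 divn_small //;
    have := ap i3; lia.
have e1 : ((a q + b q) %% p q = if q == i3 then a q + b q - p q else a q + b q)%N.
  by have e := divn_eq (a q + b q) (p q); rewrite e2 in e; case: ifP e => _ {2}->;
    rewrite ?mul1n ?mul0n ?addKn.
rewrite e1 e2 /res /cnum => h; have [h1 h2] := h; split=> //.
by rewrite h2; case: ifP => _; rewrite ?addr0 // -PoszD addn1.
Qed.

(* Characterizes the polynomials of the elements x_i^m w, for w of degree
   y + b_q x_q - m x_i. *)
Definition divis (i : 'I_t) (m : nat) (q : 'I_t) (F : {poly k}) : Prop :=
  (size F <= (cnum q).+1)%N /\
  ((m <= res q i)%N \/ exists2 G : {poly k}, (size G <= cnum q)%N & F = ell i * G).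

Lemma divis_dehom i m q s : q \in I -> (m <= p i)%N ->
  Sdeg (y - xv i *+ m + xv q *+ b q) s ->
  divis i m q (dehom (y + xv q *+ b q) (xS i ^+ m * s)).
Proof.
move=> qI mp; rewrite addrAC => ds; have nfq := nf_yb qI; split.
  apply: (dehom_size nfq); rewrite -[X in Sdeg X](subrK (xv i *+ m)) addrC.
  by apply: SdegM => //; apply: SdegXn.
have [h|[G sG eG]] := dehom_divx nfq mp ds; first by left.
by right; exists G; rewrite // -(psize_pred (cnum q)).
Qed.

Lemma dehom_divis i m q F : q \in I -> (m <= p i)%N -> divis i m q F ->
  exists2 s, Sdeg (y - xv i *+ m + xv q *+ b q) s &
    dehom (y + xv q *+ b q) (xS i ^+ m * s) = F.
Proof.
move=> qI mp [sF hF]; have nfq := nf_yb qI; have [s ds es] := dehom_surj nfq sF.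
have [|u du eu] := Sdeg_divx nfq mp ds.
  case: hF => [h|[G sG eG]]; first by left.
  by right; exists G; rewrite ?psize_pred ?es.
by exists u; [rewrite addrAC|rewrite -eu].
Qed.

Lemma divis0 i m q : divis i m q 0.
Proof. by split; [rewrite size_poly0|right; exists 0;
  rewrite ?size_poly0 ?mulr0]. Qed.

(* At the vertex 0 the image of O(y) consists of the triples (C, C, ell_i3 C);
   these coordinates of the quotient eliminate the first component. *)
Definition upic (F1 F2 F3 : {poly k}) : {poly k} := F2 - F1.
Definition dpic (F1 F2 F3 : {poly k}) : {poly k} := rr *: (F3 - ell i3 * F1).

Let sB (P Q : {poly k}) d : (size P <= d)%N -> (size Q <= d)%N ->
  (size (P - Q)%R <= d)%N.
Proof. by move=> sP sQ; rewrite (leq_trans (size_polyD _ _)) // geq_max sP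
  size_polyN. Qed.
Let sZ (c : k) (P : {poly k}) d : (size P <= d)%N -> (size (c *: P)%R <= d)%N.
Proof. exact: leq_trans (size_scale_leq _ _). Qed.
Let sM (P : {poly k}) i d : (size P <= d)%N -> (size (@ell k W i * P)%R <= d.+1)%N.
Proof. by rewrite mulrC; apply: size_mul_ell. Qed.

Let c1 : cnum i1 = n. Proof. by rewrite /cnum (negPf ne13). Qed.
Let c2 : cnum i2 = n. Proof. by rewrite /cnum (negPf ne23). Qed.
Let c3 : cnum i3 = n.+1. Proof. by rewrite /cnum eqxx. Qed.

(** F_q must be divisible by [ell i] once m exceeds [res q i]. At level L2 this leaves free only F1
    on the arm i1 and only F2 on the arm i2, while on the arm i3 only F3 is constrained. *)
Lemma picture_in i m F1 F2 F3 : (m <= p i)%N ->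
  divis i m i1 F1 -> divis i m i2 F2 -> divis i m i3 F3 ->
  exists c : 'cV[k]_(ldim n (lev i m)),
    up (amx i m (lev i m) *m c) = upic F1 F2 F3 /\
    dn (amx i m (lev i m) *m c) = dpic F1 F2 F3.
Proof.
move=> mp [s1 d1] [s2 d2] [s3 d3]; rewrite c1 c2 c3 in s1 s2 s3 d1 d2 d3.
rewrite /upic /dpic.
have L3case : exists c : 'cV[k]_(ldim n L3),
    up (amx i m L3 *m c) = F2 - F1 /\ dn (amx i m L3 *m c) = rr *:
      (F3 - ell i3 * F1).
  by apply: armmx_surj3; [exact: sB|apply/sZ/sB => //; apply: sM].
have L1case : (0 < m)%N ->
    (exists2 G : {poly k}, (size G <= n)%N & F1 = ell i * G) ->
    (exists2 G : {poly k}, (size G <= n)%N & F2 = ell i * G) ->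
    (exists2 G : {poly k}, (size G <= n.+1)%N & F3 = ell i * G) ->
  exists c : 'cV[k]_(ldim n L1),
    up (amx i m L1 *m c) = F2 - F1 /\ dn (amx i m L1 *m c) = rr *:
      (F3 - ell i3 * F1).
  move=> m0 [G1 sG1 ->] [G2 sG2 ->] [G3 sG3 ->].
  have [||c [uc dc]] := @armmx_surj1 _ _ i1 i3 n i m (G2 - G1) (rr *:
    (G3 - ell i3 * G1)) m0.
  - exact: sB.
  - by apply/sZ/sB => //; apply: sM.
  by exists c; rewrite uc dc; split; rewrite -?mul_polyC; ring.
have L2case : (0 < m)%N -> (exists2 G : {poly k}, (size G <= n.+1)%N &
    rr *: (F3 - ell i3 * F1) = kappa i1 i3 i * (F2 - F1) + ell i * G) ->
  exists c : 'cV[k]_(ldim n L2),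
    up (amx i m L2 *m c) = F2 - F1 /\ dn (amx i m L2 *m c) = rr *:
      (F3 - ell i3 * F1).
  by move=> m0 [G sG ->]; apply: (armmx_surj2 lt12 lt23) => //; apply: sB.
have ng (d e : nat) (P : Prop) : (d < e)%N -> (e <= d)%N \/ P -> P.
  by move=> de [|//]; rewrite leqNgt de.
rewrite /arm_level; move: d1 d2 d3; rewrite /res (negPf ne13) (negPf ne23) eqxx.
have [e|i_3] := eqVneq i i3.
  subst i; rewrite ![i3 == _]eq_sym (negPf ne13) (negPf ne23) => d1 d2 d3.
  case: leqP => m1; first exact: L3case.
  have m0 : (0 < m)%N by apply: leq_ltn_trans m1.
  have [G3 sG3 e3] := ng _ _ _ m1 d3.
  case: leqP => m2.
    apply: L2case => //; exists (rr *: (G3 - F1)); first by apply/sZ/sB.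
    by rewrite /kappa eq_sym (negPf ne13) e3 -!mul_polyC; ring.
  by apply: L1case => //; [exact: ng d1|exact: ng d2|exists G3].
have [e|i_1] := eqVneq i i1.
  subst i; rewrite (negPf ne12) => d1 d2 d3.
  case: leqP => m1; first exact: L3case.
  have m0 : (0 < m)%N by apply: leq_ltn_trans m1.
  have [G3 sG3 e3] := ng _ _ _ m1 d3.
  have [G2 sG2 e2] := ng _ _ _ m1 d2.
  case: leqP => m2.
    (* The free component F1 drops out of V - [kappa] U, which is [rr] (F3 - ell_i3 F2). *)
    apply: L2case => //; exists (rr *: (G3 - ell i3 * G2)).
      by apply/sZ/sB => //; apply: sM.
    by rewrite /kappa eqxx e2 e3 -!mul_polyC; ring.
  by apply: L1case => //; [exact: ng d1|exists G2|exists G3].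
have [e|i_2] := eqVneq i i2.
  subst i => d1 d2 d3 /=.
  case: leqP => m1; first exact: L3case.
  have m0 : (0 < m)%N by apply: leq_ltn_trans m1.
  have [G3 sG3 e3] := ng _ _ _ m1 d3.
  have [G1 sG1 e1] := ng _ _ _ m1 d1.
  case: leqP => m2.
    apply: L2case => //; exists (rr *: (G3 - ell i3 * G1)).
      by apply/sZ/sB => //; apply: sM.
    by rewrite /kappa (negPf i_1) e1 e3 -!mul_polyC; ring.
  by apply: L1case => //; [exists G1|exact: ng d2|exists G3].
move=> d1 d2 d3; case: leqP => m1; first exact: L3case.
have m0 : (0 < m)%N by apply: leq_ltn_trans m1.
by apply: L1case => //; [exact: ng d1|exact: ng d2|exact: ng d3].
Qed.

Lemma picture_out i m (c : 'cV[k]_(ldim n (lev i m))) : exists F1 F2 F3,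
  [/\ divis i m i1 F1, divis i m i2 F2, divis i m i3 F3,
    up (amx i m (lev i m) *m c) = upic F1 F2 F3 &
    dn (amx i m (lev i m) *m c) = dpic F1 F2 F3].
Proof.
have rr0 : rr != 0 by apply: (rescale_neq0 lt12 lt23).
pose goal U V := exists F1 F2 F3,
  [/\ divis i m i1 F1, divis i m i2 F2, divis i m i3 F3, U = upic F1 F2 F3 & V =
    dpic F1 F2 F3].
(* A preimage with F1 = 0, which works everywhere except in the middle of the arm i1, where F2 would
   have to be divisible by [ell i1]. *)
have pic0 U V : divis i m i2 U -> divis i m i3 (rr^-1 *: V) -> goal U V.
  move=> d2 d3; exists 0, U, (rr^-1 *: V); split=> //; first exact: divis0.
    by rewrite /upic subr0.
  by rewrite /dpic mulr0 subr0 scalerA divff // scale1r.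
have piece q (G : {poly k}) : (size G <= cnum q)%N -> divis i m q (ell i * G).
  by move=> sG; split; [exact: sM|right; exists G].
have piece3 (G : {poly k}) : (size G <= n.+1)%N -> divis i m i3 (rr^-1 *:
  (ell i * G)).
  by move=> sG; rewrite scalerAr; apply: piece; rewrite c3; apply: sZ.
have L3case (c' : 'cV_(ldim n L3)) : (m <= res i2 i)%N -> (m <= res i3 i)%N ->
    goal (up (amx i m L3 *m c')) (dn (amx i m L3 *m c')).
  move=> m2 m3; apply: pic0; split; try by left.
    by rewrite c2; apply: size_up.
  by rewrite c3; apply/sZ/size_dn.
have L1case (c' : 'cV_(ldim n L1)) : (0 < m)%N ->
    goal (up (amx i m L1 *m c')) (dn (amx i m L1 *m c')).
  move=> m0; have [-> ->] := armmx1E i1 i3 i c' m0.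
  by apply: pic0; [apply: piece; rewrite c2; apply: size_up|apply/piece3/size_dn].
have L2case (c' : 'cV_(ldim n L2)) : (0 < m)%N -> (m <= res i2 i)%N -> i != i1 ->
    goal (up (amx i m L2 *m c')) (dn (amx i m L2 *m c')).
  move=> m0 m2 ni1; have [G sG ->] := armmx2E lt12 lt23 i c' m0.
  rewrite /kappa (negPf ni1) mul0r add0r; apply: pic0; last exact: piece3.
  by split; [rewrite c2; apply: size_up|left].
(* The type of c depends on the level, so the level is abstracted before the case analysis. *)
suff main l : lev i m = l -> forall c' : 'cV_(ldim n l),
  goal (up (amx i m l *m c')) (dn (amx i m l *m c')) by exact: main.
rewrite /arm_level; have [e|i_3] := eqVneq i i3.
  subst i; case: leqP => m1.
    move=> <- c'; apply: L3case; rewrite /res ?eqxx // [i3 == _]eq_sym (negPf ne23).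
    exact: leq_trans m1 c3_le.
  have m0 : (0 < m)%N by apply: leq_ltn_trans m1.
  case: leqP => m2 <- c'; last exact: L1case.
  by apply: L2case => //; rewrite ?[i3 == _]eq_sym // /res [i3 ==
    _]eq_sym (negPf ne23).
have [e|i_1] := eqVneq i i1.
  subst i; case: leqP => m1 /=.
    by move=> <- c'; apply: L3case; rewrite /res ?(negPf ne12) ?(negPf ne13).
  have m0 : (0 < m)%N by apply: leq_ltn_trans m1.
  case: leqP => m2 <- c'; last exact: L1case.
  have [G sG ->] := armmx2E lt12 lt23 i1 c' m0; rewrite /kappa eqxx.
  (* The free component F1 carries U, and the multiple [kappa] U of V comes from it. *)
  set U := up _; exists (- U), 0, (rr^-1 *: (ell i1 * G)); split.
  - split; first by rewrite size_polyN c1; apply: size_up.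
    by left; rewrite /res eqxx (negPf ne13).
  - exact: divis0.
  - exact: piece3.
  - by rewrite /upic opprK add0r.
  rewrite /dpic mulrN opprK scalerDr scalerA divff // scale1r addrC.
  by rewrite scalerAl.
have [e|i_2] := eqVneq i i2.
  subst i; case: leqP => m1 /=.
    move=> <- c'; apply: L3case; rewrite /res ?eqxx ?(negPf ne23) //.
    exact: leq_trans m1 (leq_addr _ _).
  have m0 : (0 < m)%N by apply: leq_ltn_trans m1.
  case: leqP => m2 <- c'; last exact: L1case.
  by apply: L2case => //; rewrite /res eqxx (negPf ne23).
case: leqP => m1 <- c'; last by apply: L1case; apply: leq_ltn_trans m1.
by apply: L3case; rewrite /res ?(negPf i_2) ?(negPf i_3).
Qed.

Lemma lev0 i : lev i 0 = L3.
Proof. by rewrite /arm_level !leq0n !if_same. Qed.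

Lemma lev_end i : lev i (p i) = L1.
Proof.
have F d e : (e < d)%N -> (d <= e)%N = false by move=> ed; apply/negbTE;
  rewrite -ltnNge.
rewrite /arm_level; have [->|_] := eqVneq i i3.
  by rewrite (F _ _ c3_lt) (F _ _ (ap i3)).
have [->|_] := eqVneq i i1; first by rewrite (F _ _ (ap i1)) (F _ _ nocarry1).
have [->|_] /= := eqVneq i i2; first by rewrite (F _ _ (ap i2)) (F _ _ nocarry2).
by rewrite (F _ _ (ap i)).
Qed.

Lemma lev_desc i m : descends (lev i m) (lev i m.+1).
Proof.
have h x z : descends (if (m <= x)%N then L3 else if (m <= z)%N then L2 else L1)
    (if (m < x)%N then L3 else if (m < z)%N then L2 else L1).
  case: (ltnP m x) => [h1|_]; first by rewrite (ltnW h1).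
  case: (ltnP m z) => [h2|_]; first by rewrite (ltnW h2); case: ifP.
  by case: ifP => // _; case: ifP.
rewrite /arm_level; case: ifP => // _; case: ifP => // _.
case: (ltnP m (a i)) => [h1|_]; first by rewrite (ltnW h1).
by case: ifP.
Qed.

(** The two end vertices lie on every arm; the first is chosen for them, and [crel_at] shows that
    any other would do. *)
Definition armof (v : vertex W) : 'I_t :=
  match v with V0 => arm1 W | Vmid i _ => i | Vc => arm1 W end.
Definition posof (v : vertex W) : nat :=
  match v with V0 => 0 | Vmid _ m => m.+1 | Vc => p (arm1 W) end.

Lemma vdeg_pos v : vdeg v = xv (armof v) *+ posof v.
Proof. by case: v => //=; rewrite mulr0n. Qed.

Lemma posof_le v : (posof v <= p (armof v))%N.
Proof. by case: v => //= i m; have := ltn_ord m; lia. Qed.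

Lemma vlevel_pos v : vlevel i1 i2 i3 a b v = lev (armof v) (posof v).
Proof. by case: v => //=; rewrite ?lev0 ?lev_end. Qed.

Lemma vtx_cases i m : (m <= p i)%N ->
  [\/ m = 0%N /\ vtx i m = V0 W, m = p i /\ vtx i m = Vc W |
      armof (vtx i m) = i /\ posof (vtx i m) = m].
Proof.
case: m => [|m] mp; first by constructor 1.
rewrite /vtx; case: insubP => [u _ <-|]; first by constructor 3.
by rewrite -leqNgt => h; constructor 2; split=> //; lia.
Qed.

Local Notation vlev := (vlevel i1 i2 i3 a b).

Definition pics (i : 'I_t) (m : nat) (l : level) (w : 'I_t -> SS) (c :
  'cV[k]_(ldim n l)) : Prop :=
  let F q := dehom (y + xv q *+ b q) (xS i ^+ m * w q) in
  up (amx i m l *m c) = upic (F i1) (F i2) (F i3) /\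
  dn (amx i m l *m c) = dpic (F i1) (F i2) (F i3).

(* The isomorphism, as a relation between sections and coordinate columns: both
   are compared with the vertex 0, into which all arrows are injective. *)
Definition crel (v : vertex W) (g : HomX I b y (vdeg v))
  (c : 'cV[k]_(ldim n (vlev v))) : Prop :=
  exists2 w, represents y (- vdeg v) (val g) w & pics (armof v) (posof v) w c.

Lemma up_lin l (e : k) (c c' : 'cV[k]_(ldim n l)) : up (e *: c + c') = e *:
  up c + up c'.
Proof. by case: l c c' => c c'; rewrite /up !linearP. Qed.
Lemma dn_lin l (e : k) (c c' : 'cV[k]_(ldim n l)) : dn (e *: c + c') = e *:
  dn c + dn c'.
Proof. by case: l c c' => c c'; rewrite /dn !linearP. Qed.

Lemma crel_lin v e g c g' c' : @crel v g c -> @crel v g' c' ->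
  crel (e *: g + g') (e *: c + c').
Proof.
move=> [w gw [uw dw]] [w' gw' [uw' dw']].
exists (fun q => @kS k W e * w q + w' q); first by rewrite linearP; apply:
  represents_lin.
have hF q : dehom (y + xv q *+ b q) (xS (armof v) ^+ posof v * (@kS k W e * w q +
  w' q)) =
    e *: dehom (y + xv q *+ b q) (xS (armof v) ^+ posof v * w q) +
    dehom (y + xv q *+ b q) (xS (armof v) ^+ posof v * w' q).
  by rewrite mulrDr mulrCA raddfD /= dehomZ.
split; rewrite mulmxDr -scalemxAr (up_lin, dn_lin) (uw, dw) (uw',
  dw') !hF /upic /dpic.
  by rewrite -!mul_polyC; ring.
by rewrite -!mul_polyC; ring.
Qed.

(** The degree of a vertex lies between 0 and c, so subtracting it costs at most one c from n >=
    0. *)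
Lemma nf_yv v : exists r l, normal_form (y - vdeg v) r l /\ -1 <= l.
Proof.
rewrite vdeg_pos; have [h|h] := leqP (posof v) (a (armof v)).
  by exists (fun j => if j == armof v then a (armof v) - posof v else a j)%N,
    n%:Z; split;
    [exact: nf_subx nf_y h|].
exists (fun j => if j == armof v then a (armof v) + (p (armof v) - posof v) else a
  j)%N, (n%:Z - 1).
split; last by rewrite lerBrDr addNr.
by apply: nf_subx_carry nf_y _; rewrite h posof_le.
Qed.

Lemma crel_total v g : exists c, @crel v g c.
Proof.
have [r [l [nfv l1]]] := nf_yv v.
have [w gw] := represents_exists i2I i3I i2arm1 ne23 b2p nfv l1 (valP g).
have [dw _] := gw; rewrite vdeg_pos in dw.
have dv q (qI : q \in I) := divis_dehom qI (posof_le v) (dw q qI).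
have := picture_in (posof_le v) (dv _ i1I) (dv _ i2I) (dv _ i3I).
by rewrite -vlevel_pos => -[c hc]; exists c, w.
Qed.

Lemma crel_onto v c : exists g, @crel v g c.
Proof.
have := @picture_out (armof v) (posof v); rewrite -vlevel_pos => /(_ c).
move=> [F1 [F2 [F3 [d1 d2 d3 uc dc]]]].
have [s1 ds1 e1] := dehom_divis i1I (posof_le v) d1.
have [s2 ds2 e2] := dehom_divis i2I (posof_le v) d2.
have [s3 ds3 e3] := dehom_divis i3I (posof_le v) d3.
pose w q := if q == i1 then s1 else if q == i2 then s2 else s3.
have w1 : w i1 = s1 by rewrite /w eqxx.
have w2 : w i2 = s2 by rewrite /w eq_sym (negPf ne12) eqxx.
have w3 : w i3 = s3 by rewrite /w eq_sym (negPf ne13) eq_sym (negPf ne23).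
have [|g sg gw] := @represents_section _ _ I b y (- vdeg v) w.
  by rewrite vdeg_pos; apply: I_ind; rewrite ?w1 ?w2 ?w3.
exists (exist _ g sg : gsec _ _ _ _), w; first by [].
by split; rewrite w1 w2 w3 e1 e2 e3.
Qed.

Lemma dehom_beta q d : q \in I -> Sdeg y d ->
  dehom (y + xv q *+ b q) (xS q ^+ b q * d) =
  if q == i3 then ell i3 * dehom y d else dehom y d.
Proof.
move=> qI dd; rewrite (dehom_mulx q (b q) nf_y dd).
move: q qI; apply: I_ind; rewrite ?(negPf ne13) ?(negPf ne23) ?eqxx.
- by rewrite divn_small ?mul1r.
- by rewrite divn_small ?mul1r.
by rewrite -{1}(subnK carry3) divnDr ?dvdnn // divnn wt_gt0 divn_small ?expr1.
Qed.

Lemma Sdeg_pos v s : Sdeg (y - vdeg v) s -> Sdeg y (xS (armof v) ^+ posof v * s).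
Proof.
move=> ds; rewrite -[y](subrK (vdeg v)) addrC; apply: SdegM => //.
by rewrite vdeg_pos; apply: SdegXn.
Qed.

(** The tuple of the zero section is a boundary, which has zero coordinates at the vertex 0, and the
    arm matrices are injective. *)
Lemma crel_fun v c : @crel v 0 c -> c = 0.
Proof.
move=> [w gw [uc dc]].
have [d dd wd] := (represents_eq0 i2I i3I i2arm1 ne23 b2p gw).1 erefl.
have hF q : q \in I -> dehom (y + xv q *+ b q) (xS (armof v) ^+ posof v * w q) =
    if q == i3 then ell i3 * dehom y (xS (armof v) ^+ posof v * d)
    else dehom y (xS (armof v) ^+ posof v * d).
  by move=> qI; rewrite wd // mulrCA dehom_beta //; apply: Sdeg_pos.
apply: (@armmx_eq0 _ _ i1 i3 n (armof v) (posof v)).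
move: uc dc; rewrite !hF // eqxx (negPf ne13) (negPf ne23) /upic /dpic !subrr
  scaler0.
exact: (@updn_eq0 _ n L3).
Qed.

(** Zero coordinates say that F2 = F1 and F3 = ell_i3 F1, so the tuple becomes a boundary after
    multiplication by a power of x_i; torsion-freeness removes the power. *)
Lemma crel_inj v g : @crel v g 0 -> g = 0.
Proof.
move=> [w gw [uc dc]]; apply: val_inj; have [dw _] := gw.
have dm q : q \in I -> Sdeg (y + xv q *+ b q) (xS (armof v) ^+ posof v * w q).
  move=> qI; rewrite -[y](subrK (vdeg v)) [y - _ + _]addrC -addrA; apply: SdegM;
    last exact: dw.
  by rewrite vdeg_pos; apply: SdegXn.
move: uc dc; rewrite mulmx0 (@up0 k n L3) (@dn0 k n L3) /upic /dpic.
move=> /esym/eqP; rewrite subr_eq0 => /eqP e2 /esym/eqP.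
rewrite scaler_eq0 (negPf (rescale_neq0 lt12 lt23)) subr_eq0 /= => /eqP e3.
have [|c dc ec] := dehom_surj nf_y (F :=
  dehom (y + xv i1 *+ b i1) (xS (armof v) ^+ posof v * w i1)).
  by have := dehom_size (nf_yb i1I) (dm i1 i1I); rewrite c1.
have hc q : q \in I -> xS (armof v) ^+ posof v * w q = xS q ^+ b q * c.
  move=> qI; apply: (dehom_inj (dm q qI)).
    by rewrite addrC; apply: SdegM => //; apply: SdegXn.
  rewrite dehom_beta // ec; move: q qI.
  by apply: I_ind; rewrite ?(negPf ne13) ?(negPf ne23) ?eqxx.
exact: (represents_torsion i2I i3I i2arm1 ne23 b2p gw (SdegXn (armof v) (posof v))
  (xSn_neq0 (armof v) (posof v)) hc).
Qed.

(** At [Vc], passing from the first arm to the arm i multiplies both the components and the column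
    side by [ell i], by [armmx1E]; at [V0] all powers are trivial. *)
Lemma crel_at i m v g c : (m <= p i)%N -> v = vtx i m -> @crel v g c ->
  exists2 w, represents y (- vdeg v) (val g) w & pics i m w c.
Proof.
move=> mp ev; case: (vtx_cases mp) => [[m0 e]|[mpi e]|[e1 e2]].
- have {e}ev : v = V0 W by rewrite ev.
  by subst v; move=> [w gw pw]; exists w; rewrite // m0; move: pw;
    rewrite /pics !expr0.
- have {e}ev : v = Vc W by rewrite ev.
  subst v m; move=> [w gw [uc dc]]; exists w; first exact: gw.
  have [dw _] := gw.
  have hF j q : q \in I -> dehom (y + xv q *+ b q) (xS j ^+ p j * w q) =
      ell j * dehom (y - cv W + xv q *+ b q) (w q).
    move=> qI; have := dehom_wtX j 1 (dw q qI).
    by rewrite muln1 expr1 mulr1n -/(vdeg (Vc W)) addrAC subrK.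
  have [u1' d1'] := armmx1E i1 i3 (arm1 W) c (wt_gt0 (arm1 W)).
  have [u2' d2'] := armmx1E i1 i3 i c (wt_gt0 i).
  move: uc dc; rewrite /pics u1' d1' u2' d2' !hF // ell_arm1 !mul1r => -> ->.
  by rewrite /upic /dpic -!mul_polyC; split; ring.
by rewrite -ev in e1 e2; rewrite /crel e1 e2.
Qed.

Lemma crel_of i m v g c : (m < p i)%N -> v = vtx i m ->
  (exists2 w, represents y (- vdeg v) (val g) w & pics i m w c) -> @crel v g c.
Proof.
move=> mp ev; case: (vtx_cases (ltnW mp)) => [[m0 e]|[me _]|[e1 e2]].
- have {e}ev : v = V0 W by rewrite ev.
  by subst v; move=> [w gw pw]; exists w => //; move: pw; rewrite m0 /pics !expr0.
- by rewrite me ltnn in mp.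
by rewrite -ev in e1 e2; rewrite /crel e1 e2.
Qed.

Lemma vlev_vtx i m : (m <= p i)%N -> vlev (vtx i m) = lev i m.
Proof.
move=> mp; rewrite vlevel_pos; case: (vtx_cases mp) => [[-> ->]|[-> ->]|[-> ->]]
  //=.
  by rewrite !lev0.
by rewrite !lev_end.
Qed.

(** Going along the arrow and then to the vertex 0 is the longer path on both sides, so the
    coordinates at the vertex 0 do not change. *)
Lemma crel_arrow i (m : 'I_(p i)) g c : @crel (vtx i m.+1) g c ->
  crel (HomX_pre (vdeg_arrow m) g) (arrow_mx i1 i2 i3 n a b m *m c).
Proof.
move=> /(crel_at (ltn_ord m) erefl)[w gw [uc dc]].
apply: (crel_of (ltn_ord m) erefl); exists (fun q => xS i * w q).
  have e : - vdeg (vtx i m.+1) + xv i =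
    - vdeg (vtx i m) by rewrite vdeg_arrow opprD addrNK.
  by have := represents_mulx i gw; rewrite e; apply.
have hm : amx i m (vlev (vtx i m)) *m arrow_mx i1 i2 i3 n a b m =
    amx i m.+1 (vlev (vtx i m.+1)).
  apply: armmxS.
    by move=> m0; rewrite m0.
  by rewrite !vlev_vtx ?(ltnW (ltn_ord m)) //; apply: lev_desc.
have hF q : xS i ^+ m * (xS i * w q) = xS i ^+ m.+1 * w q by rewrite exprSr mulrA.
by rewrite /pics mulmxA hm !hF; split; [exact: uc|exact: dc].
Qed.

Lemma coker_rep_iso : rep_iso (coker_rep I b y) (matrix_rep i1 i2 i3 n a b).
Proof.
have h v := linear_bij_of_rel (@crel_lin v) (@crel_total v) (@crel_onto v)
  (@crel_fun v) (@crel_inj v).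
pose phi v := projT1 (cid (h v)); have phiP v := projT2 (cid (h v)).
exists phi; split=> [v|i m u]; first by have [] := phiP v.
have [c hc] := crel_total u; have [_ e] := phiP (vtx i m.+1); have [_ e'] :=
  phiP (vtx i m).
rewrite (e _ _ hc); apply: e'; exact: crel_arrow.
Qed.

End B3.

Theorem theorem6 (k : closedFieldType) (W : weights k)
  (i1 i2 i3 : 'I_(nb W)) (n : nat) (a b : 'I_(nb W) -> nat)
  (lt12 : (i1 < i2)%N) (lt23 : (i2 < i3)%N)
  (a_lt : forall i, (a i <= wt i - 1)%N)
  (b_bound : forall i, i \in [set i1; i2; i3] -> (1 <= b i <= wt i - 1)%N)
  (carry3 : (wt i3 <= a i3 + b i3)%N)
  (nocarry1 : (a i1 + b i1 < wt i1)%N)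
  (nocarry2 : (a i2 + b i2 < wt i2)%N) :
  rep_iso
    (coker_rep [set i1; i2; i3] b (cv W *+ n + \sum_i xv i *+ a i))
    (matrix_rep i1 i2 i3 n a b).
Proof.
exact: coker_rep_iso.
Qed.
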